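(* There exist universal constants $c,C,\tilde\gamma_1,\tilde\gamma_2>0$ and $N\in\mathbb{N}$ such that the following holds for all integers $n\ge N$ and all integers $k$ with $1\le k\le n/32$. Let $v\in\mathbb{R}^n$ be a fixed nonzero vector, let $i^*\in\arg\max_{1\le i\le n}|v(i)|$, let $\tilde v_1,\dots,\tilde v_k$ be independent random vectors with distribution $N(0,I_n)$, and let $W=\operatorname{span}\{v,\tilde v_1,\dots,\tilde v_k\}\subset\mathbb{R}^n$. Let $s=\left\lfloor c\,\frac{n/\sqrt{\log n}}{\sqrt{k}}\right\rfloor$ and let $v_s$ be the best $s$-sparse approximation of $v$. Then, with probability at least $$1-\tilde\gamma_1e^{-\tilde\gamma_2n/2}-k\,e^{-\lfloor c\sqrt{n/\log n}\rfloor}-\frac{k}{n^2},$$ every minimizer $z^\#$ of the optimization problem $$\min\|z\|_1\quad\text{such that}\quad z\in W,\ z(i^* )=1$$ satisfies $$\left\|z^\#-\frac{v}{v(i^* )}\right\|_2\le C\,\frac{\sqrt{k\log n}}{\sqrt n}\,\frac{\|v-v_s\|_1}{\|v\|_\infty}.$$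
   Context: $v(i)$ denotes the $i$-th component of a vector $v$. The best $s$-sparse approximation $v_s$ of $v$ is the vector obtained from $v$ by keeping $s$ entries of largest absolute value and setting all other entries to zero (ties broken arbitrarily). ''Universal'' means not depending on $n$, $k$ or $v$. $\log$ is the natural logarithm. *)

(* Defs.v *)
From HB Require Import structures.
From mathcomp Require Export all_boot all_order all_algebra.
From mathcomp Require Export all_classical all_reals all_analysis.

Set Implicit Arguments.
Unset Strict Implicit.
Unset Printing Implicit Defensive.

Export Order.TTheory GRing.Theory Num.Theory.
Export numFieldNormedType.Exports.

Local Open Scope classical_set_scope.
Local Open Scope ring_scope.

(* Vectors of R^n are row vectors. The sup norm of v is the library norm `|v|
   of 'rV[R]_n (see mx_normrE). *)

Definition l1norm (R : realType) (n : nat) (v : 'rV[R]_n) : R :=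
  \sum_i `|v 0 i|.

Definition l2norm (R : realType) (n : nat) (v : 'rV[R]_n) : R :=
  Num.sqrt (\sum_i v 0 i ^+ 2).

(* A predicate rather than a function: every way of breaking ties is allowed.
   For s >= n nothing is discarded. *)
Definition best_sparse_approx (R : realType) (n s : nat) (v vs : 'rV[R]_n) :
    Prop :=
  exists S : {set 'I_n},
    [/\ #|S| = minn s n,
        forall i j, i \in S -> j \notin S -> `|v 0 j| <= `|v 0 i|
      & vs = \row_i (if i \in S then v 0 i else 0)].

(* R^n with its Borel sigma-algebra. *)
Definition borel_rV (R : realType) (n : nat) : measurableType _ :=
  g_sigma_algebraType (@open 'rV[R]_n).

Definition mutually_independent (R : realType) (d d' : measure_display)
    (T : measurableType d) (T' : measurableType d') (P : probability T R)
    (I : finType) (X : I -> {RV P >-> T'}) : Prop :=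
  forall (J : {set I}) (A : I -> set T'),
    (forall i, measurable (A i)) ->
    P (\bigcap_(i in [set` J]) X i @^-1` A i) =
      (\prod_(i in J) P (X i @^-1` A i))%E.

(* N(0, I_n) is the n-fold product of N(0, 1); a Borel probability measure on
   R^n is determined by its values on measurable boxes. *)
Definition std_gaussian_vector (R : realType) (d : measure_display)
    (T : measurableType d) (P : probability T R) (n : nat)
    (X : {RV P >-> borel_rV R n}) : Prop :=
  forall A : 'I_n -> set R,
    (forall i, measurable (A i)) ->
    distribution P X [set x : 'rV[R]_n | forall i, A i (x 0 i)] =
      (\prod_(i < n) normal_prob 0 1 (A i))%E.

Definition is_l1_minimizer (R : realType) (n : nat)
    (W : {vspace 'rV[R]_n}) (i : 'I_n) (z : 'rV[R]_n) : Prop :=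
  [/\ z \in W, z 0 i = 1
    & forall y : 'rV[R]_n, y \in W -> y 0 i = 1 -> l1norm z <= l1norm y].

(* Main.v *)
(* Write v' = v / v(istar) and let G be the Gaussian matrix with columns tv_j.  A
   feasible z has z - v' = u with u = G y - t v' and t = (G y)(istar), so it
   is enough to control all vectors of this shape.  Minimality of z gives the cone
   inequality |u|_1 <= 2 |u_S|_1 + 2 |v'_{S^c}|_1, S the support of v_s.

   If all entries of G are at most 3 sqrt(ln n), which fails with probability
   at most k / n^2, then |u_i| <= 6 sqrt(k ln n) |y| for all i, so |u_S|_1 is
   small against n |y| by the choice of s and |u|_2 <= 6 sqrt(n k ln n) |y|.
   What remains is |u|_1 >= c n |y| for all y and all t = O(n |y|).  For fixed t
   and fixed y of norm about 1 the coordinates of G y - t v' are independent with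
   bounded density, so |G y - t v'|_1 is below a small multiple of n with
   probability at most 8^-n.  A union bound over a net in y (at most 2^n points,
   as k <= n / 32) and a grid in t, together with the bound |G y|_1 = O(n |y|),
   gives the claim. *)

From HB Require Import structures.
Require Import Defs.
From mathcomp Require Import zify ring lra measurable_realfun.

Set Implicit Arguments.
Unset Strict Implicit.
Unset Printing Implicit Defensive.

Local Open Scope classical_set_scope.
Local Open Scope ring_scope.

(** * Integrals against the normal law *)

Section normal_moments.
Context {R : realType}.
Local Notation leb := (@lebesgue_measure R).
Import HBNNSimple.

(** A simple function is a finite combination of indicators of its fibres, and for an indicator the
    identity is the definition of [normal_prob] through its density. *)
Lemma integral_normal_prob_nnsfun (m s : R)
    (f : {nnsfun (measurableTypeR R) >-> R}) :
  (\int[normal_prob m s]_x (f x)%:E =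
   \int[leb]_x ((f x)%:E * (normal_pdf m s x)%:E))%E.
Proof.
have mpdf := measurable_normal_pdf m s.
have mpdfE : measurable_fun [set: measurableTypeR R] (EFin \o normal_pdf m s).
  exact/measurable_EFinP.
have mind r : measurable_fun [set: measurableTypeR R]
    (fun x => (r * \1_(f @^-1` [set r]) x)%:E).
  by apply/measurable_EFinP/measurable_funM => //; exact: measurable_indic.
under [LHS]eq_integral do rewrite fimfunE -fsumEFin//.
under [RHS]eq_integral.
  move=> x _; rewrite fimfunE -fsumEFin//.
  rewrite ge0_mule_fsuml; last first.
    by move=> r; rewrite EFinM nnfun_muleindic_ge0.
  over.
rewrite !ge0_integral_fsum//.
- apply: eq_fsbigr => r _.
  rewrite integralZl_indic_nnsfun// integral_indic// setIT.
  (* A negative value [r] has an empty fibre, so both sides vanish. *)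
  have [r0|r0] := leP 0 r; last first.
    rewrite preimage_nnfun0// measure0 mule0 integral0_eq// => x _.
    by rewrite indic0 mulr0 mul0e.
  under [RHS]eq_integral do rewrite EFinM -muleA.
  rewrite ge0_integralZl//.
  + congr *%E; rewrite /= [LHS]integral_mkcond/=; apply: eq_integral => x _.
    rewrite patchE indicE; case: ifPn => _; first by rewrite mul1e.
    by rewrite mul0e.
  + by apply: emeasurable_funM => //; apply/measurable_EFinP; exact: measurable_indic.
  + by move=> x _; rewrite mule_ge0// lee_fin ?normal_pdf_ge0.
- by move=> r; apply: emeasurable_funM => //; exact: mind.
- move=> r x _; rewrite mule_ge0// ?lee_fin ?normal_pdf_ge0//.
  by rewrite -lee_fin EFinM nnfun_muleindic_ge0.
- by move=> r x _; rewrite EFinM nnfun_muleindic_ge0.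
Qed.

(** Monotone convergence on both sides along an increasing sequence of simple functions. *)
Lemma integral_normal_prob (m s : R) (f : measurableTypeR R -> R) :
  measurable_fun setT f -> (forall x, 0 <= f x) ->
  (\int[normal_prob m s]_x (f x)%:E =
   \int[leb]_x ((f x)%:E * (normal_pdf m s x)%:E))%E.
Proof.
move=> mf f0; have mpdf := measurable_normal_pdf m s.
have mpdfE : measurable_fun [set: measurableTypeR R] (EFin \o normal_pdf m s).
  exact/measurable_EFinP.
have mfE : measurable_fun [set: measurableTypeR R] (EFin \o f).
  exact/measurable_EFinP.
pose f_ := nnsfun_approx measurableT mfE.
transitivity (lim (\int[normal_prob m s]_x (f_ n x)%:E @[n --> \oo])%E).
  rewrite -monotone_convergence//=.
  - apply: eq_integral => ? /[!inE] xD; apply/esym/cvg_lim => //=.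
    by apply: cvg_nnsfun_approx => // x _; rewrite lee_fin.
  - by move=> n; exact/measurable_EFinP/measurable_funTS.
  - by move=> n ? _; rewrite lee_fin.
  - by move=> ? _ ? ? mn; rewrite lee_fin; exact/lefP/nd_nnsfun_approx.
transitivity (lim (\int[leb]_x ((f_ n x)%:E * (normal_pdf m s x)%:E) @[n --> \oo])%E).
  by apply: congr_lim; apply/funext => n; rewrite integral_normal_prob_nnsfun.
rewrite -monotone_convergence//=.
- apply: eq_integral => x /[!inE] xD; apply/cvg_lim => //=.
  apply: cvgeZr => //.
  by apply: cvg_nnsfun_approx => // y _; rewrite lee_fin.
- by move=> n; apply: emeasurable_funM => //; exact/measurable_EFinP.
- by move=> n x _; rewrite mule_ge0// lee_fin// normal_pdf_ge0.
- move=> x _ a b ab; rewrite lee_pmul// ?lee_fin ?normal_pdf_ge0//.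
  exact/lefP/nd_nnsfun_approx.
Qed.

(** Completing the square: the integrand times the standard density is a constant times the normal
    density of mean [th / (1 + 2 * lam)] and variance [(1 + 2 * lam)^-1]. *)
Lemma integral_expR_normal01 (lam th : R) : 0 <= lam ->
  (\int[normal_prob 0 1]_x (expR (- (lam * x ^+ 2) + th * x))%:E =
   ((Num.sqrt (1 + 2 * lam))^-1
      * expR (th ^+ 2 / (2 * (1 + 2 * lam))))%:E)%E.
Proof.
move=> lam0; rewrite integral_normal_prob; last 2 first.
- apply: measurableT_comp => //; apply: measurable_funD => //.
    by apply: measurableT_comp => //; apply: measurable_funM.
- by move=> x; exact: expR_ge0.
have v0 : 0 < 1 + 2 * lam by lra.
set s := Num.sqrt (1 + 2 * lam).
have s0 : 0 < s by rewrite sqrtr_gt0.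
have s2 : s ^+ 2 = 1 + 2 * lam by rewrite sqr_sqrtr// ltW.
pose m := th / (1 + 2 * lam).
under eq_integral => x _.
  rewrite (_ : (_ * _)%E = ((s^-1 * expR (th ^+ 2 / (2 * (1 + 2 * lam))))%:E
     * (normal_pdf m s^-1 x)%:E)%E); last first.
    rewrite -!EFinM; congr EFin.
    rewrite !normal_pdfE ?invr_eq0 ?gt_eqF// /normal_peak /normal_fun.
    rewrite exprVn s2 expr1n mul1r -mulrnAr.
    rewrite [X in _ = _ * (X * _)](_ : _ = s * (Num.sqrt (pi *+ 2))^-1); last first.
      rewrite sqrtrM ?invr_ge0 ?ltW// sqrtrV ?ltW// -/s invfM invrK//.
    set P := (Num.sqrt (pi *+ 2))^-1.
    have E : expR (- (lam * x ^+ 2) + th * x) * expR (- (x - 0) ^+ 2 / 2) =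
        expR (th ^+ 2 / (2 * (1 + 2 * lam))) *
        expR (- (x - m) ^+ 2 / ((1 + 2 * lam)^-1 *+ 2)).
      rewrite -!expRD; congr expR; rewrite /m.
      by field; rewrite ?gt_eqF.
    by rewrite mulrCA E; field; rewrite gt_eqF.
  over.
rewrite ge0_integralZl//=.
- by rewrite integral_normal_pdf mule1.
- by apply/measurable_EFinP; exact: measurable_normal_pdf.
- by move=> x _; rewrite lee_fin normal_pdf_ge0.
- by rewrite lee_fin mulr_ge0 ?expR_ge0// invr_ge0 ltW.
Qed.
End normal_moments.

(** * Independence *)

Section joint_law.
Context {R : realType} {d : measure_display} {T : measurableType d}.
Variable P : probability T R.

Definition mfun_of (f : T -> R) (mf : measurable_fun setT f) : {mfun T >-> R} :=
  HB.pack f (isMeasurableFun.Build _ _ _ _ f mf).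

Lemma preimage_measurable (f : T -> R) (A : set R) :
  measurable_fun setT f -> measurable A -> measurable (f @^-1` A).
Proof. by move=> mf mA; rewrite -[X in measurable X]setTI; exact: mf. Qed.

(** Two finite measures on the plane that agree on rectangles, a pi-system, agree everywhere. The
    event [D] carries the remaining variables of a family along while two of them are combined. *)
Lemma joint_lawE (X Y : {mfun T >-> R}) (D : set T) : measurable D ->
  (forall A B, measurable A -> measurable B ->
    P (X @^-1` A `&` Y @^-1` B `&` D) =
    (P (X @^-1` A) * P (Y @^-1` B) * P D)%E) ->
  forall E : set (R * R), measurable E ->
    P ((fun w => (X w, Y w)) @^-1` E `&` D) =
    ((distribution P X \x distribution P Y)%E E * P D)%E.
Proof.
move=> mD XYD E mE.
have mXY : measurable_fun [set: T] (fun w => (X w, Y w)).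
  exact: measurable_fun_pair.
pose pm : {measure set (R * R) -> \bar R} :=
  pushforward (mrestr P mD) (fun w => (X w, Y w)).
pose m1 := pm mXY.
have p0 : (0 <= fine (P D))%R by rewrite fine_ge0.
pose m2 : {measure set (R * R) -> \bar R} :=
  mscale (NngNum p0) (distribution P X \x distribution P Y)%E.
have m2E F : m2 F = ((distribution P X \x distribution P Y)%E F * P D)%E.
  by rewrite /m2 /= /mscale/= fineK ?fin_num_measure// muleC.
rewrite -m2E; change (m1 E = m2 E).
pose C : set (set (R * R)) :=
  [set C | exists A, measurable A /\ exists B, measurable B /\ C = A `*` B].
have CI : setI_closed C.
  move=> /= _ _ [X1 [mX1 [X2 [mX2 ->]]]] [Y1 [mY1 [Y2 [mY2 ->]]]].
  rewrite -setXI; exists (X1 `&` Y1); split; first exact: measurableI.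
  by exists (X2 `&` Y2); split => //; exact: measurableI.
apply: (measure_unique C (fun=> setT)) => //.
- rewrite measurable_prod_measurableType //; congr (<<s _ >>).
  rewrite predeqE => S; split => [[A mA [B mB <-]]|[A [mA [B [mB ->]]]]].
    by exists A; split => //; exists B.
  by exists A => //; exists B.
- move=> _; exists setT; split => //; exists setT; split => //.
  by rewrite setXTT.
- by rewrite bigcup_const//; exists 0%N.
- move=> _ [A [mA [B [mB ->]]]].
  rewrite m2E product_measure1E//= /m1 /pushforward/= /mrestr.
  by rewrite -XYD.
- move=> _; rewrite /m1 /pushforward/= /mrestr/=.
  rewrite (le_lt_trans (probability_le1 _ _)) ?ltry//.
  by rewrite preimage_setT setTI.
Qed.

End joint_law.

Section independence.
Context {R : realType} {d : measure_display} {T : measurableType d}.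
Variable P : probability T R.

(** The product rule is asked for the whole index type; subfamilies follow by taking [setT] for the
    other [B i]. *)
Definition independent (K : finType) (X : K -> T -> R) :=
  (forall i, measurable_fun setT (X i)) /\
  forall B : K -> set R, (forall i, measurable (B i)) ->
    P (\bigcap_i X i @^-1` B i) = (\prod_i P (X i @^-1` B i))%E.

Lemma independent_sub (K : finType) (X : K -> T -> R) (J : pred K)
    (B : K -> set R) : independent X -> (forall i, measurable (B i)) ->
  P (\bigcap_(i in [set i | J i]) X i @^-1` B i) =
  (\prod_(i | J i) P (X i @^-1` B i))%E.
Proof.
move=> [_ XI] mB; pose B' i := if J i then B i else setT.
rewrite big_mkcond/= (_ : \bigcap_(i in _) _ = \bigcap_i X i @^-1` B' i).
  rewrite XI; last by move=> i; rewrite /B'; case: ifP.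
  apply: eq_bigr => i _; rewrite /B'; case: ifP => // _.
  by rewrite preimage_setT probability_setT.
apply/seteqP; split=> w Bw i /=; rewrite /B'.
  by move=> _; case: ifPn => // Ji; exact: Bw.
by move=> Ji; have := Bw i I; rewrite /B' /= Ji.
Qed.

Lemma independent2 (K : finType) (a b : K) (X : K -> T -> R) (A1 A2 : set R) :
  a != b -> independent X -> measurable A1 -> measurable A2 ->
  P (X a @^-1` A1 `&` X b @^-1` A2) = (P (X a @^-1` A1) * P (X b @^-1` A2))%E.
Proof.
move=> ab indX mA1 mA2.
pose B2 i := if i == a then A1 else if i == b then A2 else setT.
have mB2 i : measurable (B2 i) by rewrite /B2; do 2 case: ifP => // _.
have := independent_sub [pred i | (i == a) || (i == b)] indX mB2.
rewrite (bigD1 a)/=; last by rewrite eqxx.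
rewrite (bigD1 b)/=; last by rewrite eqxx orbT eq_sym.
rewrite big_pred0; last first.
  by move=> i; case: (i == a); case: (i == b).
rewrite mule1 /B2 eqxx eq_sym (negbTE ab) eqxx => <-.
congr (P _); apply/seteqP; split => [w [w1 w2] i /=|w w12].
  by case/orP => /eqP ->; rewrite ?eqxx// eq_sym (negbTE ab) ?eqxx.
split.
  by have := w12 a; rewrite /= eqxx; exact.
by have := w12 b; rewrite /= eqxx orbT [b == a]eq_sym (negbTE ab); exact.
Qed.

(* Replacing X b by 0, instead of dropping it, keeps the index type fixed. *)
Definition merge (K : finType) (a b : K) (c : R) (X : K -> T -> R) : K -> T -> R :=
  fun i => if i == a then (fun w => X a w + c * X b w)
           else if i == b then cst 0 else X i.

(** The event splits into a condition on [a], one on [b] and an event [D] for the other indices. By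
    [joint_lawE] the condition on the new sum becomes the product measure of a plane set [E]; using
    this once with [D] and once with [setT] factors out [P D]. *)
Lemma independent_merge (K : finType) (a b : K) (c : R) (X : K -> T -> R) :
  a != b -> independent X -> independent (merge a b c X).
Proof.
move=> ab indX; have [mX XI] := indX.
have mXab : measurable_fun setT (fun w => X a w + c * X b w).
  by apply: measurable_funD => //; exact: measurable_funM.
split=> [i|B mB]; first by rewrite /merge; do 2 case: ifP => // _.
pose J : pred K := [pred i | (i != a) && (i != b)].
pose D := \bigcap_(i in [set i | J i]) X i @^-1` B i.
have split3 A1 A2 (Y : K -> T -> R) : (forall i, J i -> Y i = X i) ->
    Y a @^-1` A1 `&` Y b @^-1` A2 `&` D =
    \bigcap_i Y i @^-1` (if i == a then A1 else if i == b then A2 else B i).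
  move=> YX; apply/seteqP; split=> w /=.
    move=> [[A1w A2w] Dw] i _; case: eqVneq => [->//|ia].
    case: eqVneq => [->//|ib] /=; have Ji : J i by rewrite /J/= ia ib.
    by rewrite YX//; exact: Dw.
  move=> Yw; split; first split.
  - by have := Yw a I; rewrite eqxx.
  - by have := Yw b I; rewrite eqxx eq_sym (negbTE ab).
  - move=> i /= Ji; rewrite -YX//; have := Yw i I.
    by case/andP : Ji => /negbTE -> /negbTE ->.
have PD : P D = (\prod_(i | J i) P (X i @^-1` B i))%E.
  exact: independent_sub.
have mD : measurable D.
  by apply: fin_bigcap_measurable => // i _; exact: preimage_measurable.
have PabD A1 A2 : measurable A1 -> measurable A2 ->
    P (X a @^-1` A1 `&` X b @^-1` A2 `&` D) =
    (P (X a @^-1` A1) * P (X b @^-1` A2) * P D)%E.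
  move=> mA1 mA2; rewrite split3// XI; last by move=> i; do 2 case: ifP => // _.
  rewrite (bigD1 a)//= (bigD1 b) 1?eq_sym//= eqxx eq_sym (negbTE ab) eqxx muleA.
  congr *%E; rewrite PD; apply: eq_bigr => i /andP[ia ib].
  by rewrite (negbTE ia) (negbTE ib).
set Y := merge a b c X.
have YX i : J i -> Y i = X i.
  by case/andP => /negbTE ia /negbTE ib; rewrite /Y /merge ia ib.
rewrite (_ : \bigcap_i _ = Y a @^-1` B a `&` Y b @^-1` B b `&` D); last first.
  rewrite split3//; apply: eq_bigcapr => i _.
  have [->//|_] := eqVneq i a; by have [->|_] := eqVneq i b.
rewrite (bigD1 a)//= (bigD1 b) 1?eq_sym//= muleA.
rewrite (eq_bigr (fun i => P (X i @^-1` B i))); last first.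
  by move=> i Ji; rewrite YX//.
rewrite -[X in (_ * X)%E]PD.
have -> : Y b = cst 0 by rewrite /Y /merge eq_sym (negbTE ab) eqxx.
have -> : Y a = (fun w => X a w + c * X b w) by rewrite /Y /merge eqxx.
(* The condition on the constant 0 is either always true or never; in the second case both sides are
   0. *)
rewrite preimage_cst; case: ifPn => _; last first.
  by rewrite setI0 set0I measure0 mule0 mul0e.
rewrite setIT probability_setT mule1.
pose E := (fun z : R * R => z.1 + c * z.2) @^-1` B a.
have mE : measurable E.
  rewrite -[X in measurable X]setTI; apply: (_ : measurable_fun setT _) => //.
  apply: measurable_funD => //.
  by apply: measurable_funM => //.
have jl D' mD' h := @joint_lawE _ _ _ P (mfun_of (mX a)) (mfun_of (mX b)) D' mD' h E mE.
have := jl D mD PabD; rewrite /= => ->.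
have := jl setT measurableT; rewrite setIT probability_setT mule1 /= => <-//.
by move=> A1 A2 mA1 mA2; rewrite setIT mule1 independent2.
Qed.

End independence.

(** * Linear forms in independent Gaussian variables *)

Lemma measurable_expR_quad {R : realType} {d : measure_display}
    {T : measurableType d} (Z : T -> R) (lam th : R) : measurable_fun setT Z ->
  measurable_fun setT (fun w => (expR (- (lam * Z w ^+ 2) + th * Z w))%:E).
Proof.
move=> mZ; apply/measurable_EFinP; apply: measurableT_comp => //.
apply: measurable_funD; last exact: measurable_funM.
apply: measurableT_comp => //; apply: measurable_funM => //.
exact: measurable_funX.
Qed.

Section linear_forms.
Context {R : realType} {d : measure_display} {T : measurableType d}.
Variable P : probability T R.

(* For Z ~ N(0, v) the exponential moments of quadratic polynomials are explicit.
   This family is stable under adding independent Gaussians, also for v = 0, and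
   contains what is needed later: lam = 0 gives Chernoff tail bounds, and
   lam = dl^-2 gives the small-ball bound. *)
Definition gauss_transform (Z : T -> R) (v : R) :=
  forall lam th : R, 0 <= lam ->
  (\int[P]_w (expR (- (lam * Z w ^+ 2) + th * Z w))%:E =
   ((Num.sqrt (1 + 2 * lam * v))^-1
      * expR (v * th ^+ 2 / (2 * (1 + 2 * lam * v))))%:E)%E.

(** By Tonelli [Y] is integrated out first. With [q = 1 + 2 * lam * c ^+ 2] the result is a constant
    times the same exponential in [Z] with parameters [lam / q] and [th / q], so the formula for [Z]
    applies. *)
Lemma gauss_transformD (Z Y : T -> R) (v c : R) :
  measurable_fun setT Z -> measurable_fun setT Y ->
  (forall A B, measurable A -> measurable B ->
    P (Z @^-1` A `&` Y @^-1` B) = (P (Z @^-1` A) * P (Y @^-1` B))%E) ->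
  0 <= v -> gauss_transform Z v -> gauss_transform Y 1 ->
  gauss_transform (fun w => Z w + c * Y w) (v + c ^+ 2).
Proof.
move=> mZ mY ZY v0 gZ gY lam th lam0.
pose f (z : R * R) := expR (- (lam * (z.1 + c * z.2) ^+ 2) + th * (z.1 + c * z.2)).
have mf : measurable_fun setT (EFin \o f).
  apply: (@measurable_expR_quad _ _ _ (fun z : R * R => z.1 + c * z.2)).
  by apply: measurable_funD => //; exact: measurable_funM.
have f0 z : (0 <= (EFin \o f) z)%E by rewrite lee_fin expR_ge0.
have mZY : measurable_fun [set: T] (fun w => (Z w, Y w)).
  exact: measurable_fun_pair.
pose LZ := distribution P (mfun_of mZ).
pose LY := distribution P (mfun_of mY).
transitivity (\int[LZ \x LY]_z (EFin \o f) z)%E.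
  transitivity (\int[pushforward P (fun w => (Z w, Y w))]_z (EFin \o f) z)%E.
    by rewrite ge0_integral_pushforward.
  apply: eq_measure_integral => E mE _.
  have := @joint_lawE _ _ _ P (mfun_of mZ) (mfun_of mY) setT measurableT _ E mE.
  rewrite setIT probability_setT mule1; apply.
  by move=> A B mA mB; rewrite setIT mule1 ZY.
rewrite fubini_tonelli1//.
pose q := 1 + 2 * lam * c ^+ 2.
have q0 : 0 < q by rewrite /q; have := mulr_ge0 lam0 (sqr_ge0 c); lra.
pose K := (Num.sqrt q)^-1 * expR (c ^+ 2 * th ^+ 2 / (2 * q)).
rewrite ge0_integral_distribution//; last 2 first.
- by apply: measurable_fun_fubini_tonelli_F => //.
- by move=> y; apply: integral_ge0.
under eq_integral => w _.
  rewrite /= /fubini_F ge0_integral_distribution//; last first.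
    apply: (@measurable_expR_quad _ _ _ (fun y : R => Z w + c * y)).
    by apply: measurable_funD => //; exact: measurable_funM.
  under eq_integral => w' _.
    rewrite (_ : (_ \o _) w' = (expR (- (lam * Z w ^+ 2) + th * Z w))%:E *
      (expR (- ((lam * c ^+ 2) * Y w' ^+ 2) +
             (c * (th - 2 * lam * Z w)) * Y w'))%:E)%E; last first.
      by rewrite -EFinM -expRD /= /f; congr (expR _)%:E; rewrite /=; ring.
    over.
  rewrite ge0_integralZl ?lee_fin ?expR_ge0//; last exact: measurable_expR_quad.
  rewrite gY; last by rewrite mulr_ge0 ?sqr_ge0.
  rewrite (_ : (_ * _)%E = K%:E *
    (expR (- ((lam / q) * Z w ^+ 2) + (th / q) * Z w))%:E)%E; last first.
    rewrite -!EFinM; congr EFin; rewrite /K mulrCA -[RHS]mulrA.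
    rewrite (_ : 1 + 2 * (lam * c ^+ 2) * 1 = q); last by rewrite /q; ring.
    congr (_ * _); rewrite -!expRD; congr expR.
    by rewrite /q; field; rewrite gt_eqF.
  over.
rewrite ge0_integralZl ?lee_fin ?mulr_ge0 ?invr_ge0 ?expR_ge0//; last first.
  exact: measurable_expR_quad.
rewrite gZ ?divr_ge0 ?(ltW q0)// -EFinM; congr EFin.
rewrite /K mulrACA -expRD -invfM -sqrtrM ?(ltW q0)//.
have E : q * (1 + 2 * (lam / q) * v) = 1 + 2 * lam * (v + c ^+ 2).
  by rewrite /q; field; rewrite gt_eqF.
have qv0 : 0 < 1 + 2 * lam * (v + c ^+ 2).
  by have := mulr_ge0 lam0 (sqr_ge0 c); have := mulr_ge0 lam0 v0; lra.
rewrite E; congr (_ * expR _).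
rewrite (_ : 1 + 2 * (lam / q) * v = (1 + 2 * lam * (v + c ^+ 2)) / q); last first.
  by rewrite -E [RHS]mulrC mulKf// gt_eqF.
by rewrite /q in q0 *; field; rewrite !gt_eqF.
Qed.

Lemma gauss_transform0 : gauss_transform (fun=> 0) 0.
Proof.
move=> lam th _; under eq_integral do rewrite expr0n/= !mulr0 oppr0 addr0 expR0.
rewrite integral_cst// mul1e [LHS](@probability_setT _ _ _ P).
by rewrite mulr0 addr0 sqrtr1 invr1 !mul0r expR0 mulr1.
Qed.

(* The variables X a with a in s have been moved into the sum of their block. *)
Definition block_state (K L : finType) (p : L -> K) (c : L -> R)
    (X : L -> T -> R) (s : seq L) (z : K + L) : T -> R :=
  match z with
  | inl j => fun w => \sum_(a <- s | p a == j) c a * X a w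
  | inr a => if a \in s then cst 0 else X a
  end.

(** Induction on [s]: moving one more variable [b] into the sum of its block is exactly one
    [merge]. *)
Lemma independent_block_state (K L : finType) (p : L -> K) (c : L -> R)
    (X : L -> T -> R) (s : seq L) :
  uniq s -> independent P X -> independent P (block_state p c X s).
Proof.
move=> us indX; have [mX XI] := indX.
elim: s us => [_|b s IH /= /andP[bs us]].
  split=> [[j|a]|B mB] /=; rewrite ?in_nil//.
    by under eq_fun do rewrite big_nil; exact: measurable_cst.
  have nilE j : block_state p c X [::] (inl j) = cst 0.
    by apply/funext => w; rewrite /= big_nil.
  rewrite big_sumType.
  (* All block sums are empty, hence 0; if some [B (inl j)] misses 0, both sides vanish. *)
  have [allB|/existsNP[j jB]] := pselect (forall j, B (inl j) 0).
    rewrite big1 ?[RHS]mul1e; last first.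
      by move=> j _; rewrite nilE preimage_cst mem_set// probability_setT.
    rewrite -(XI (fun a => B (inr a)))//; congr (P _); apply/seteqP; split => w wB.
      by move=> a _; exact: (wB (inr a) I).
    by case=> [j _|a _]; [rewrite /preimage nilE; exact: allB|exact: wB].
  rewrite (bigD1 j)// nilE preimage_cst memNset// measure0 [X in _ = _ X _]mul0e [RHS]mul0e.
  rewrite (_ : bigcap _ _ = set0) ?measure0//.
  apply/seteqP; split => // w wB; apply: jB.
  by have := wB (inl j) I; rewrite /preimage nilE.
rewrite (_ : block_state _ _ _ _ =
    merge (inl (p b)) (inr b) (c b) (block_state p c X s)).
  by apply: independent_merge => //; exact: IH.
apply/funext => -[j|a]; rewrite /merge /=.
  apply/funext => w; rewrite big_cons (negbTE bs).
  rewrite (inj_eq inl_inj) eq_sym; case: ifPn => [/eqP->|//].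
  by rewrite addrC.
rewrite (inj_eq inr_inj) inE.
by case: eqVneq => [->|].
Qed.

(** Once all variables have been moved, only the block sums remain and the right summand is
    constrained by [setT]. *)
Lemma independent_block_sums (K L : finType) (p : L -> K) (c : L -> R)
    (X : L -> T -> R) : independent P X ->
  independent P (fun j w => \sum_(a | p a == j) c a * X a w).
Proof.
move=> indX.
have [mS SI] := independent_block_state p c (index_enum_uniq L) indX.
split=> [j|B mB]; first exact: (mS (inl j)).
pose B' (z : K + L) := match z with inl j => B j | inr _ => setT end.
have := SI B'; rewrite big_sumType /= [X in (_ * X)%E]big1 ?mule1; last first.
  by move=> a _; rewrite preimage_setT probability_setT.
move=> <-; last by move=> [j|a] /=.
congr (P _); apply/seteqP; split => w wB.
  by case=> [j _|//]; exact: wB.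
by move=> j _; exact: (wB (inl j) I).
Qed.

(** Terms are added one at a time; the block state with a single block supplies the independence of
    the partial sum and the next variable. *)
Lemma gauss_transform_sum (L : finType) (c : L -> R) (X : L -> T -> R) :
  independent P X -> (forall a, gauss_transform (X a) 1) ->
  gauss_transform (fun w => \sum_a c a * X a w) (\sum_a c a ^+ 2).
Proof.
move=> indX gX; elim: (index_enum L) (index_enum_uniq L) => [_|b s IH /= /andP[bs us]].
  by rewrite big_nil; under eq_fun do rewrite big_nil; exact: gauss_transform0.
rewrite big_cons addrC; under eq_fun do rewrite big_cons addrC.
have indS := independent_block_state (fun=> tt) c us indX.
have SE : block_state (fun=> tt) c X s (inl tt) = (fun w => \sum_(a <- s) c a * X a w).
  by apply/funext => w /=; apply: eq_bigl.
have SbE : block_state (fun=> tt) c X s (inr b) = X b by rewrite /= (negbTE bs).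
apply: gauss_transformD => //.
- by rewrite -SE; exact: indS.1.
- exact: indX.1.
- by move=> A B mA mB; rewrite -SE -SbE; exact: independent2.
- by apply: sumr_ge0 => a _; exact: sqr_ge0.
- exact: IH.
Qed.

End linear_forms.

(** * Tail and small-ball estimates *)

Lemma expR1_le4 {R : realType} : expR 1 <= 4 :> R.
Proof.
have h : 2^-1 <= expR (- 2^-1) :> R by have := @expR_ge1Dx R (- 2^-1); lra.
have e2 : expR 2^-1 <= 2 :> R.
  by rewrite -[expR _]invrK -expRN invf_ple ?posrE ?expR_gt0.
rewrite [X in expR X](_ : _ = 2^-1 + 2^-1); last lra.
rewrite expRD; apply: (le_trans (ler_pM _ _ e2 e2)); rewrite ?expR_ge0//; lra.
Qed.

Lemma measure_bigcup_le {R : realType} {d : measure_display}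
    {T : measurableType d} (P : probability T R) (I : finType) (A : I -> set T) :
  (forall i, measurable (A i)) -> (P (\bigcup_i A i) <= \sum_i P (A i))%E.
Proof.
move=> mA; suff : (P (\bigcup_(i in [set` index_enum I]) A i) <= \sum_i P (A i))%E.
  apply: le_trans; rewrite le_measure ?inE//.
  - exact: fin_bigcup_measurable.
  - exact: fin_bigcup_measurable.
  - by move=> w [i _ Aiw]; exists i => //=; exact: mem_index_enum.
elim: (index_enum I) => [|b s IH].
  by rewrite big_nil (_ : bigcup _ _ = set0) ?measure0//; apply/seteqP; split => w // -[].
rewrite big_cons.
have -> : \bigcup_(i in [set` b :: s]) A i = A b `|` \bigcup_(i in [set` s]) A i.
  apply/seteqP; split => w /=.
    move=> [i /=]; rewrite inE => /orP[/eqP->|si] Aiw; first by left.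
    by right; exists i.
  by move=> [Abw|[i /= si Aiw]]; [exists b|exists i] => //=; rewrite inE ?eqxx// si orbT.
apply: le_trans (leeD (lexx _) IH); apply: measureU2 => //.
exact: fin_bigcup_measurable.
Qed.

Section gaussian_estimates.
Context {R : realType} {d : measure_display} {T : measurableType d}.
Variable P : probability T R.

Lemma le_probability_integral (A : set T) (g : T -> R) :
  measurable A -> measurable_fun setT g -> (forall w, 0 <= g w) ->
  (forall w, A w -> 1 <= g w) -> (P A <= \int[P]_w (g w)%:E)%E.
Proof.
move=> mA mg g0 g1; rewrite -(setIT A) -integral_indic//.
apply: ge0_le_integral => //.
- by apply/measurable_EFinP; exact: measurable_indic.
- exact/measurable_EFinP.
- move=> w _; rewrite lee_fin indicE.
  by have [wA|_] := boolP (w \in A); [exact/g1/set_mem|exact: g0].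
Qed.

(** Chernoff's bound with [lam = 0] and [th = t / V], the optimal parameter for variance [V]. *)
Lemma gaussian_tail (Z : T -> R) (v V t : R) :
  measurable_fun setT Z -> gauss_transform P Z v -> v <= V -> 0 < V ->
  0 <= t -> (P [set w | (t <= Z w)%R] <= (expR (- (t ^+ 2 / (2 * V))))%:E)%E.
Proof.
move=> mZ gZ vV V0 t0; pose th := t / V.
have := @le_probability_integral [set w | t <= Z w]
  (fun w => expR (- (th * t)) * expR (- (0 * Z w ^+ 2) + th * Z w)).
have mq := measurable_expR_quad 0 th mZ.
rewrite [X in _ -> _ -> _ -> _ -> (_ <= X)%E](_ : _ =
  ((expR (- (th * t)))%:E * \int[P]_w (expR (- (0 * Z w ^+ 2) + th * Z w))%:E)%E);
  last first.
  under eq_integral do rewrite EFinM.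
  by rewrite ge0_integralZl// ?lee_fin ?expR_ge0// => w _; rewrite lee_fin expR_ge0.
rewrite gZ// => h; apply: (le_trans (h _ _ _ _)).
- rewrite -[X in measurable X]setTI (_ : [set w | _] = Z @^-1` `[t, +oo[).
    exact: mZ.
  by apply/seteqP; split => w /=; rewrite in_itv/= andbT.
- by apply: measurable_funM => //; exact/measurable_EFinP.
- by move=> w; rewrite mulr_ge0 ?expR_ge0.
- move=> w /= tZ; rewrite -expRD -[leLHS]expR0 ler_expR.
  have : 0 <= th * (Z w - t) by rewrite mulr_ge0 ?subr_ge0// divr_ge0// ltW.
  by rewrite mul0r oppr0 add0r mulrBr; lra.
rewrite -EFinM lee_fin mulr0 mul0r addr0 sqrtr1 invr1 mul1r -expRD ler_expR.
rewrite mulr1 /th.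
have -> : - (t / V * t) = - (t ^+ 2 / (2 * V)) - V * ((t / V) ^+ 2 / 2).
  by field; rewrite gt_eqF.
have : v * ((t / V) ^+ 2 / 2) <= V * ((t / V) ^+ 2 / 2).
  by rewrite ler_wpM2r// divr_ge0// sqr_ge0.
rewrite !mulrA; lra.
Qed.

(** The indicator is dominated by the exponential of [1 - lam * (Z - a) ^+ 2]. Its mean is at most
    [expR 1 / Num.sqrt (1 + 2 * lam * v)] whatever the centre [a]; here [expR 1 <= 4], and the root
    is at least [(2 * dl)^-1] since [4^-1 <= v]. *)
Lemma gaussian_small_ball (Z : T -> R) (v a dl : R) :
  measurable_fun setT Z -> gauss_transform P Z v -> 4^-1 <= v -> 0 < dl ->
  (P [set w | (`|Z w - a| <= dl)%R] <= (8 * dl)%:E)%E.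
Proof.
move=> mZ gZ v4 dl0; pose lam := (dl ^+ 2)^-1.
have v0 : 0 < v by lra.
have lam0 : 0 < lam by rewrite invr_gt0 exprn_gt0.
pose th := 2 * lam * a.
have := @le_probability_integral [set w | `|Z w - a| <= dl]
  (fun w => expR (1 - lam * a ^+ 2) * expR (- (lam * Z w ^+ 2) + th * Z w)).
have mq := measurable_expR_quad lam th mZ.
rewrite [X in _ -> _ -> _ -> _ -> (_ <= X)%E](_ : _ =
  ((expR (1 - lam * a ^+ 2))%:E * \int[P]_w (expR (- (lam * Z w ^+ 2) + th * Z w))%:E)%E);
  last first.
  under eq_integral do rewrite EFinM.
  by rewrite ge0_integralZl// ?lee_fin ?expR_ge0// => w _; rewrite lee_fin expR_ge0.
rewrite gZ; last exact: ltW.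
move=> h; apply: (le_trans (h _ _ _ _)).
- rewrite -[X in measurable X]setTI (_ : [set w | _] = Z @^-1` `[a - dl, a + dl]).
    exact: mZ.
  by apply/seteqP; split => w /=; rewrite in_itv/= ler_distl.
- by apply: measurable_funM => //; exact/measurable_EFinP.
- by move=> w; rewrite mulr_ge0 ?expR_ge0.
- move=> w /= Za; rewrite -expRD -[leLHS]expR0 ler_expR.
  have : lam * (Z w - a) ^+ 2 <= 1.
    rewrite /lam mulrC ler_pdivrMr ?exprn_gt0// mul1r -real_normK ?num_real//.
    by rewrite lerXn2r// nnegrE ltW.
  by rewrite sqrrB /th; lra.
rewrite -EFinM lee_fin.
have q0 : 0 < 1 + 2 * lam * v by have := mulr_gt0 lam0 v0; lra.
rewrite mulrCA -expRD.
have -> : 1 - lam * a ^+ 2 + v * th ^+ 2 / (2 * (1 + 2 * lam * v)) =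
   1 - lam * a ^+ 2 / (1 + 2 * lam * v).
  by rewrite /th; field; rewrite gt_eqF.
apply: (@le_trans _ _ ((Num.sqrt (1 + 2 * lam * v))^-1 * expR 1)).
  rewrite ler_wpM2l ?invr_ge0// ler_expR lerBlDr lerDl.
  by rewrite divr_ge0// ?(ltW q0)// mulr_ge0 ?sqr_ge0// ltW.
rewrite mulrC ler_pdivrMr ?sqrtr_gt0//.
apply: (le_trans expR1_le4).
have : (2 * dl)^-1 <= Num.sqrt (1 + 2 * lam * v).
  rewrite -[leLHS]ger0_norm ?invr_ge0 ?mulr_ge0 ?(ltW dl0)// -sqrtr_sqr.
  rewrite ler_sqrt ?(ltW q0)//.
  have -> : ((2 * dl)^-1) ^+ 2 = lam / 4 by rewrite /lam; field; rewrite gt_eqF.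
  have : lam * 4^-1 <= lam * v by rewrite ler_wpM2l// ltW.
  lra.
rewrite -(ler_pM2l (_ : 0 < 8 * dl)) ?mulr_gt0//.
apply: le_trans.
by rewrite (_ : _ / _ = 4)//; field; rewrite gt_eqF.
Qed.

End gaussian_estimates.

Lemma prode_le_const {R : realType} (I : finType) (J : {set I})
    (F : I -> \bar R) (c : R) :
  (forall i, (0 <= F i)%E) -> (forall i, (F i <= c%:E)%E) ->
  (\prod_(i in J) F i <= (c ^+ #|J|)%:E)%E.
Proof.
move=> F0 Fc; rewrite -prodr_const.
suff [] : (0%:E <= \prod_(i in J) F i)%E /\
          (\prod_(i in J) F i <= (\prod_(i in J) c)%:E)%E by [].
apply: (big_rec2 (fun x (y : R) => (0%:E <= x)%E /\ (x <= y%:E)%E)).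
  by rewrite lee_fin ler01.
move=> i x y _ [y0 yx]; split; first exact: mule_ge0.
by rewrite EFinM; apply: lee_pmul.
Qed.

(** * Images of a fixed vector under a Gaussian matrix *)

Section gaussian_array.
Context {R : realType} {d : measure_display} {T : measurableType d}.
Variables (P : probability T R) (n k : nat) (xi : 'I_n * 'I_k -> T -> R).
Hypothesis xi_ind : independent P xi.
Hypothesis xi_gauss : forall a, gauss_transform P (xi a) 1.

Definition row_form (y : 'I_k -> R) (i : 'I_n) (w : T) : R :=
  \sum_j y j * xi (i, j) w.

Lemma sum_fst_eq (F : 'I_n * 'I_k -> R) (i : 'I_n) :
  \sum_(a | a.1 == i) F a = \sum_j F (i, j).
Proof.
rewrite (eq_bigl (fun a => (a.1 == i) && true)); last by move=> a; rewrite andbT.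
rewrite (eq_bigr (fun a => F (a.1, a.2))); last by case.
by rewrite -(pair_big (fun a => a == i) (fun=> true) (fun a b => F (a, b)))/= big_pred1_eq.
Qed.

Lemma row_form_independent (y : 'I_k -> R) : independent P (row_form y).
Proof.
have := independent_block_sums (fun a => a.1) (fun a => y a.2) xi_ind.
congr (independent P _); apply/funext => i; apply/funext => w.
by rewrite sum_fst_eq.
Qed.

Lemma measurable_row_form (y : 'I_k -> R) (i : 'I_n) :
  measurable_fun setT (row_form y i).
Proof. exact: (row_form_independent y).1. Qed.

(** The row is viewed as a linear form in the whole array, with coefficient 0 outside row [i]. *)
Lemma row_form_gauss (y : 'I_k -> R) (i : 'I_n) :
  gauss_transform P (row_form y i) (\sum_j y j ^+ 2).
Proof.
have := gauss_transform_sum (fun a => if a.1 == i then y a.2 else 0) xi_ind xi_gauss.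
congr (gauss_transform P _ _).
  apply/funext => w; rewrite /row_form -(sum_fst_eq (fun a => y a.2 * xi a w) i).
  rewrite [RHS]big_mkcond/=; apply: eq_bigr => a _.
  by case: ifP => // _; rewrite mul0r.
rewrite -(sum_fst_eq (fun a => y a.2 ^+ 2) i) [RHS]big_mkcond/=; apply: eq_bigr => a _.
by case: ifP => // _; rewrite expr0n.
Qed.

(** The signed sum is one linear form in all entries, of variance at most [n], so the tail exponent
    at [4 * n] is [8 * n]. This leaves room for a union over all sign patterns and net points. *)
Lemma signed_sum_tail (y : 'I_k -> R) (s : 'I_n -> bool) :
  (0 < n)%N -> \sum_j y j ^+ 2 <= 1 ->
  (P [set w | (4 * n%:R <= \sum_i (-1) ^+ s i * row_form y i w)%R]
    <= (expR (- (8 * n%:R)))%:E)%E.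
Proof.
move=> n0 y1; have n0' : 0 < n%:R :> R by rewrite ltr0n.
have := gauss_transform_sum (fun a => (-1) ^+ s a.1 * y a.2) xi_ind xi_gauss.
set Z := fun w => \sum_a _; set v := \sum_a _ => gZ.
have mZ : measurable_fun setT Z.
  apply: measurable_sum => a; apply: measurable_funM => //; exact: xi_ind.1.
have ZE w : Z w = \sum_i (-1) ^+ s i * row_form y i w.
  rewrite /Z (eq_bigr (fun a => (-1) ^+ s a.1 * (y a.2 * xi (a.1, a.2) w))); last first.
    by case=> i j _; rewrite mulrA.
  rewrite -(pair_bigA _ (fun i j => (-1) ^+ s i * (y j * xi (i, j) w)))/=.
  by apply: eq_bigr => i _; rewrite mulr_sumr.
have vn : v <= n%:R.
  rewrite /v -(pair_bigA _ (fun i j => ((-1) ^+ s i * y j) ^+ 2))/=.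
  have -> : n%:R = \sum_(i < n) (1 : R) by rewrite sumr_const card_ord.
  apply: ler_sum => i _; rewrite (le_trans _ y1)//; apply: ler_sum => j _.
  by rewrite exprMn -signr_odd sqrr_sign mul1r.
under eq_fun do rewrite -ZE.
have t0 : 0 <= 4 * n%:R :> R by rewrite mulr_ge0.
have := gaussian_tail mZ gZ vn n0' t0.
rewrite (_ : (4 * n%:R) ^+ 2 / (2 * n%:R) = 8 * n%:R)//.
by field; rewrite gt_eqF.
Qed.

Lemma entry_tail (a : 'I_n * 'I_k) (t : R) : 0 <= t ->
  (P [set w | (t <= `|xi a w|)%R] <= (2 * expR (- (t ^+ 2 / 2)))%:E)%E.
Proof.
move=> t0; have mX := xi_ind.1 a.
have mN : measurable_fun setT (fun w => - xi a w).
  exact: measurableT_comp.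
have gN : gauss_transform P (fun w => - xi a w) 1.
  move=> lam th lam0; have := xi_gauss a (- th) lam0.
  rewrite sqrrN => <-; apply: eq_integral => w _.
  by rewrite sqrrN mulrN mulNr.
have := gaussian_tail mX (xi_gauss a) (lexx 1) ltr01 t0.
have := gaussian_tail mN gN (lexx 1) ltr01 t0.
rewrite mulr1 => h1 h2.
have -> : [set w | (t <= `|xi a w|)%R] = [set w | t <= xi a w] `|` [set w | t <= - xi a w].
  apply/seteqP; split => w /=; rewrite ler_normr.
    by case/orP; [left|right].
  by case=> ->; rewrite ?orbT.
have mge (Z : T -> R) : measurable_fun setT Z -> measurable [set w | t <= Z w].
  move=> mZ; rewrite (_ : [set w | _] = Z @^-1` `[t, +oo[).
    exact: preimage_measurable.
  by apply/seteqP; split => w /=; rewrite in_itv/= andbT.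
apply: le_trans (measureU2 _ _ _) _ => //; [exact: mge|exact: mge|].
by rewrite mulr_natl mulr2n EFinD; exact: leeD.
Qed.

(* If the l1 distance is small then at least half of the coordinates are small;
   the 2^n choices of these coordinates are absorbed by (8 * dl)^(n / 2) = 2^(-4n). *)
Lemma small_l1_prob (y : 'I_k -> R) (b : 'I_n -> R) (dl : R) :
  4^-1 <= \sum_j y j ^+ 2 -> dl = 2^-1 ^+ 11 ->
  (P [set w | (\sum_i `|row_form y i w - b i| < dl * n%:R / 2)%R]
    <= (8^-1 ^+ n)%:E)%E.
Proof.
move=> y4 dlE; have dl0 : 0 < dl by rewrite dlE exprn_gt0.
pose B i : set R := [set x | `|x - b i| <= dl].
have mB i : measurable (B i).
  rewrite (_ : B i = `[b i - dl, b i + dl]%classic); first exact: measurable_itv.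
  by apply/seteqP; split => x /=; rewrite /B/= in_itv/= ler_distl.
(* [J] stands for the set of small coordinates. Sets with less than half of the indices get the
   empty event, so the union may range over all [J]. *)
pose A (J : {set 'I_n}) := if (n <= 2 * #|J|)%N
  then \bigcap_(i in [set i | i \in J]) row_form y i @^-1` B i else set0.
have mA J : measurable (A J).
  rewrite /A; case: ifP => // _; apply: fin_bigcap_measurable => // i _.
  by apply: preimage_measurable => //; exact: measurable_row_form.
have PA J : (P (A J) <= (16^-1 ^+ n)%:E)%E.
  rewrite /A; case: ifP => [nJ|_]; last by rewrite measure0 lee_fin exprn_ge0// invr_ge0.
  rewrite (independent_sub (fun i => i \in J) (row_form_independent y) mB).
  (* Each coordinate is small with probability at most [8 * dl = 2^-1 ^+ 8 = 16^-1 ^+ 2]. *)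
  apply: (@le_trans _ _ ((16^-1 ^+ 2) ^+ #|J|)%:E); last first.
    rewrite lee_fin -exprM ler_wiXn2l// ?invr_ge0//; lra.
  apply: prode_le_const => // i.
  apply: (le_trans (gaussian_small_ball (b i) (measurable_row_form y i)
    (row_form_gauss y i) y4 dl0)).
  by rewrite lee_fin dlE; lra.
apply: (@le_trans _ _ (P (\bigcup_J A J))).
  rewrite le_measure ?inE//.
  - rewrite (_ : [set w | _] = (fun w => \sum_i `|row_form y i w - b i|) @^-1`
        `]-oo, (dl * n%:R / 2)%R[%classic).
      apply: preimage_measurable => //; apply: measurable_sum => i.
      apply: measurableT_comp => //; apply: measurable_funB => //.
      exact: measurable_row_form.
    by apply/seteqP; split => w /=; rewrite in_itv.
  - exact: fin_bigcup_measurable.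
  - move=> w /= sw; pose J := [set i | `|row_form y i w - b i| <= dl]%SET.
    exists J => //; rewrite /A; case: leqP => [_ i /=|nJ]; first by rewrite inE.
    move: sw; rewrite ltNge => /negP; case.
    (* Otherwise more than half of the coordinates exceed [dl], contradicting the smallness of the
       sum. *)
    apply: (@le_trans _ _ (\sum_(i in ~: J) dl)); last first.
      rewrite [leRHS](bigID (mem (~: J)%SET))/= -[leLHS]addr0 lerD ?sumr_ge0//.
      by apply: ler_sum => i; rewrite !inE -ltNge => /ltW.
    rewrite sumr_const -[leRHS]mulr_natr -mulrA ler_wpM2l ?(ltW dl0)//.
    rewrite ler_pdivrMr// -natrM ler_nat mulnC.
    have := cardsC J; rewrite card_ord => nE; clear -nJ nE; move: (#|J|) (#|~: J|) nJ nE => p q; lia.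
apply: (le_trans (measure_bigcup_le _ mA)).
apply: (@le_trans _ _ (\sum_(J : {set 'I_n}) (16^-1 ^+ n)%:E)%E).
  by apply: lee_sum => J _; exact: PA.
have cset : #|{set 'I_n}| = (2 ^ n)%N.
  by rewrite -cardsT -powersetT card_powerset cardsT card_ord.
rewrite sumEFin lee_fin sumr_const cset -[leLHS]mulr_natl natrX -exprMn.
by apply: lerXn2r; rewrite ?nnegrE; lra.
Qed.

End gaussian_array.

(** * Nets *)

(** Termwise arithmetic-geometric inequality with weights [B / A] and [A / B]; the cases [A = 0] and
    [B = 0] are separate. *)
Lemma cauchy_schwarz_sum {R : realType} (I : finType) (a b : I -> R) (A B : R) :
  0 <= A -> 0 <= B -> \sum_i a i ^+ 2 <= A ^+ 2 -> \sum_i b i ^+ 2 <= B ^+ 2 ->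
  \sum_i a i * b i <= A * B.
Proof.
move=> A0 B0 aA bB.
have zero (f g : I -> R) : \sum_i f i ^+ 2 <= 0 -> \sum_i f i * g i = 0.
  move=> f0; apply: big1 => i _; apply/eqP; rewrite mulf_eq0; apply/orP; left.
  rewrite -sqrf_eq0; apply/eqP; apply: (@psumr_eq0P _ _ predT (fun i => f i ^+ 2)) => //.
    by move=> j _; exact: sqr_ge0.
  by apply/eqP; rewrite eq_le f0 sumr_ge0// => j _; exact: sqr_ge0.
have [A1|A1] := eqVneq A 0.
  by rewrite zero ?mulr_ge0// (le_trans aA)// A1 expr0n.
have [B1|B1] := eqVneq B 0.
  under eq_bigr do rewrite mulrC.
  by rewrite zero ?mulr_ge0// (le_trans bB)// B1 expr0n.
have {A1}A0 : 0 < A by rewrite lt_def A1.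
have {B1}B0 : 0 < B by rewrite lt_def B1.
have le i : a i * b i <= (B / A / 2) * a i ^+ 2 + (A / B / 2) * b i ^+ 2.
  rewrite -subr_ge0 (_ : _ - _ = (a i * B - b i * A) ^+ 2 / (2 * (A * B))).
    by rewrite divr_ge0 ?sqr_ge0// mulr_ge0// mulr_ge0 ?ltW.
  by field; rewrite !gt_eqF.
apply: (le_trans (ler_sum _ (fun i _ => le i))).
rewrite big_split/= -!mulr_sumr.
have h1 : B / A / 2 * \sum_i a i ^+ 2 <= B / A / 2 * A ^+ 2.
  by rewrite ler_wpM2l// !divr_ge0// ltW.
have h2 : A / B / 2 * \sum_i b i ^+ 2 <= A / B / 2 * B ^+ 2.
  by rewrite ler_wpM2l// !divr_ge0// ltW.
apply: le_trans (lerD h1 h2) _.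
by rewrite le_eqVlt; apply/orP; left; apply/eqP; field; rewrite !gt_eqF.
Qed.

Section net.
Context {R : realType}.
Variables k K : nat.
Hypotheses (k0 : (0 < k)%N) (K2 : (1 < K)%N).

(** A lattice point is stored as a sign and a multiple of [mesh] per coordinate. Zero has two codes,
    which only enlarges the count. *)
Definition grid := {ffun 'I_k -> bool * 'I_(k * K).+1}.

Definition grid_weight (z : grid) : nat := (\sum_j (z j).2)%N.

(** In units of [mesh] this is the l1 ball of radius [Num.sqrt k], which contains the Euclidean unit
    ball. *)
Definition net : {set grid} := [set z | (grid_weight z <= k * K)%N].

(** Chosen so that an error of [mesh] in each of the [k] coordinates has Euclidean norm [K^-1]. *)
Definition mesh : R := (K%:R * Num.sqrt k%:R)^-1.

Definition grid_point (z : grid) (j : 'I_k) : R :=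
  (-1) ^+ (z j).1 * ((z j).2%:R * mesh).

Let k0R : 0 < k%:R :> R. Proof. by rewrite ltr0n. Qed.
Let K0R : 0 < K%:R :> R. Proof. by rewrite ltr0n ltnW. Qed.
Let sk0 : 0 < Num.sqrt k%:R :> R. Proof. by rewrite sqrtr_gt0. Qed.
Let mesh0 : 0 < mesh. Proof. by rewrite invr_gt0 mulr_gt0. Qed.

(* Exponential weights: z is in the net iff q^(kK) <= q^(weight z), and the
   total weight factors over coordinates into geometric sums. *)
Lemma net_card : #|net|%:R <= (8 * K.+1%:R) ^+ k :> R.
Proof.
(* This ratio makes the geometric series at most [K + 1], while [q ^- K = (1 + K^-1) ^+ K] stays
   below [expR 1]. *)
pose q : R := K%:R / K.+1%:R.
have K1 : 0 < K.+1%:R :> R by rewrite ltr0n.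
have q0 : 0 < q by rewrite divr_gt0.
have q1 : q < 1 by rewrite ltr_pdivrMr// mul1r ltr_nat.
have qK : q ^- K <= 4.
  apply: le_trans expR1_le4.
  rewrite -exprVn invf_div (_ : K.+1%:R / K%:R = 1 + K%:R^-1); last first.
    by rewrite -[K.+1]addn1 natrD; field; rewrite gt_eqF.
  rewrite (_ : expR 1 = expR (K%:R^-1) ^+ K); last first.
    by rewrite -expRM_natl mulfV ?gt_eqF.
  by rewrite lerXn2r ?nnegrE ?expR_ge0 ?expR_ge1Dx// addr_ge0// invr_ge0 ltW.
have geo : \sum_(m < (k * K).+1) q ^+ m <= K.+1%:R.
  have := subrX1 q (k * K).+1.
  set S := \sum_(_ < _) _ => qS.
  have h : (1 - q) * S <= 1.
    have : 0 <= q ^+ (k * K).+1 by rewrite exprn_ge0// ltW.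
    lra.
  have q1E : 1 - q = K.+1%:R^-1.
    by rewrite /q -[K.+1]addn1 natrD; field; rewrite natr1 gt_eqF.
  by move: h; rewrite q1E ler_pdivrMl// mulr1.
have -> : #|net|%:R = \sum_(z in net) (1 : R) by rewrite sumr_const.
apply: (@le_trans _ _ (\sum_(z : grid) q ^- (k * K) * \prod_j q ^+ (z j).2)).
  rewrite [leLHS]big_mkcond/=; apply: ler_sum => z _.
  rewrite inE; case: ifPn => [wz|_]; last first.
    apply: mulr_ge0; first by rewrite invr_ge0 exprn_ge0// ltW.
    by apply: prodr_ge0 => j _; rewrite exprn_ge0// ltW.
  rewrite prodrXr -ler_pdivrMl ?invr_gt0 ?exprn_gt0// invrK mulr1.
  by rewrite ler_wiXn2l ?ltW.
rewrite -mulr_sumr.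
have -> : \sum_(z : grid) \prod_j q ^+ (z j).2 =
    (\sum_(p : bool * 'I_(k * K).+1) q ^+ p.2) ^+ k.
  rewrite -(bigA_distr_bigA (fun (_ : 'I_k) (p : bool * 'I_(k * K).+1) => q ^+ p.2)).
  by rewrite prodr_const card_ord.
rewrite (_ : q ^+ (k * K) = (q ^+ K) ^+ k); last by rewrite mulnC exprM.
rewrite -exprVn -exprMn.
have SE : \sum_(p : bool * 'I_(k * K).+1) q ^+ p.2 =
    (\sum_(m < (k * K).+1) q ^+ m) *+ 2.
  rewrite -(pair_bigA _ (fun (b : bool) (m : 'I_(k * K).+1) => q ^+ m))/=.
  by rewrite sumr_const card_bool.
have S0 : 0 <= \sum_(m < (k * K).+1) q ^+ m.
  by apply: sumr_ge0 => p _; rewrite exprn_ge0// ltW.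
have qK0 : 0 <= q ^- K by rewrite invr_ge0 exprn_ge0// ltW.
rewrite SE lerXn2r ?nnegrE ?mulr_ge0 ?mulrn_wge0// ?(ltW K1)//.
rewrite (_ : 8 * _ = 4 * (K.+1%:R *+ 2)); last first.
  by rewrite mulr2n; lra.
by rewrite ler_pM ?mulrn_wge0// lerMn2r geo.
Qed.

(* Rounding towards zero keeps the grid point in the unit ball and its weight at
   most k * K. *)
Lemma net_approx (y : 'I_k -> R) : \sum_j y j ^+ 2 = 1 ->
  exists2 z, z \in net &
    [/\ \sum_j grid_point z j ^+ 2 <= 1, 4^-1 <= \sum_j grid_point z j ^+ 2
      & \sum_j (y j - grid_point z j) ^+ 2 <= K%:R^-1 ^+ 2].
Proof.
move=> y1.
have yj1 j : `|y j| <= 1.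
  rewrite -(@ler_pXn2r _ 2) ?nnegrE// expr1n real_normK ?num_real// -y1.
  by rewrite (bigD1 j)//= lerDl sumr_ge0// => i _; exact: sqr_ge0.
have sk2 : Num.sqrt k%:R ^+ 2 = k%:R :> R by rewrite sqr_sqrtr ?ltW.
have skk : Num.sqrt k%:R <= k%:R :> R.
  have s1 : 1 <= Num.sqrt k%:R :> R by rewrite -[X in X <= _]sqrtr1 ler_sqrt ?ler1n // ltW.
  by rewrite -[leRHS]sk2 expr2 ler_peMl// ltW.
pose m j := Num.truncn (`|y j| / mesh).
have ym0 j : 0 <= `|y j| / mesh by rewrite divr_ge0// ltW.
have mle j : (m j)%:R <= `|y j| / mesh by rewrite truncn_le.
have mgt j : `|y j| / mesh < (m j).+1%:R by rewrite truncnS_gt.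
have mE : mesh^-1 = K%:R * Num.sqrt k%:R by rewrite /mesh invrK.
have mkK j : (m j < (k * K).+1)%N.
  rewrite ltnS -(ler_nat R); apply: (le_trans (mle j)).
  rewrite mE natrM mulrC [leRHS]mulrC -mulrA ler_wpM2l ?(ltW K0R)//.
  by rewrite (le_trans _ skk)// ler_piMr// ltW.
pose z : grid := [ffun j => (y j < 0, Ordinal (mkK j))].
have yE j : y j = (-1) ^+ (y j < 0)%R * `|y j| by rewrite -numEsign.
have ptE j : grid_point z j = (-1) ^+ (y j < 0)%R * ((m j)%:R * mesh).
  by rewrite /grid_point /z ffunE.
have mm j : (m j)%:R * mesh <= `|y j| by rewrite -ler_pdivlMr.
have dj j : (y j - grid_point z j) ^+ 2 <= mesh ^+ 2.
  rewrite ptE [X in X - _]yE -mulrBr exprMn sqrr_sign mul1r.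
  rewrite lerXn2r ?nnegrE ?subr_ge0 ?(ltW mesh0)//.
  have := mgt j; rewrite ltr_pdivrMr// -addn1 natrD mulrDl mul1r; lra.
have pj j : grid_point z j ^+ 2 <= y j ^+ 2.
  rewrite ptE exprMn sqrr_sign mul1r -[leRHS]real_normK ?num_real//.
  by rewrite lerXn2r ?nnegrE ?mulr_ge0 ?(ltW mesh0).
have dsum : \sum_j (y j - grid_point z j) ^+ 2 <= K%:R^-1 ^+ 2.
  apply: (le_trans (ler_sum _ (fun j _ => dj j))).
  have mesh2 : mesh ^+ 2 = K%:R^-1 ^+ 2 / k%:R.
    by rewrite /mesh invfM exprMn (exprVn (Num.sqrt _)) sk2.
  by rewrite sumr_const card_ord mesh2 -[leLHS]mulr_natr divfK// gt_eqF.
exists z.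
  rewrite inE /grid_weight -(ler_nat R) natr_sum natrM.
  (* The inequality [2 * a <= a ^+ 2 + 1] for [a = |y j| * Num.sqrt k]; the bounds sum to [k * K]
     because [y] has norm 1. *)
  apply: (@le_trans _ _ (\sum_(j < k) K%:R * ((y j ^+ 2 * k%:R + 1) / 2))).
    apply: ler_sum => j _; rewrite /z ffunE/=; apply: (le_trans (mle j)).
    rewrite mE mulrCA ler_wpM2l ?(ltW K0R)//.
    have : 0 <= (`|y j| * Num.sqrt k%:R - 1) ^+ 2 by exact: sqr_ge0.
    rewrite sqrrB1 exprMn sk2 real_normK ?num_real// -mulr_natl; lra.
  rewrite -mulr_sumr -mulr_suml big_split/= -mulr_suml y1 sumr_const card_ord.
  by rewrite mul1r mulrC; lra.
split=> //; first by rewrite -[X in _ <= X]y1; exact: ler_sum.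
(* As [K >= 2], the last term is at most [2^-1], which leaves [4^-1] for the grid point. *)
have : 1 <= 2 * \sum_j grid_point z j ^+ 2 + 2 * \sum_j (y j - grid_point z j) ^+ 2.
  rewrite -[X in X <= _]y1 !mulr_sumr -big_split/=; apply: ler_sum => j _.
  rewrite -subr_ge0 (_ : _ - _ = (y j - 2 * grid_point z j) ^+ 2); last by ring.
  exact: sqr_ge0.
have : K%:R^-1 ^+ 2 <= 4^-1 :> R.
  rewrite exprVn lef_pV2 ?posrE ?exprn_gt0// -natrX ler_nat.
  by rewrite (@leq_exp2r 2 K 2).
lra.
Qed.

End net.

(** * Uniform l1 estimates *)

Section deterministic.
Context {R : realType}.
Variables (n k K : nat) (x : 'I_n -> 'I_k -> R).
Hypotheses (k0 : (0 < k)%N) (K2 : (1 < K)%N).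

Definition apply_array (y : 'I_k -> R) (i : 'I_n) : R := \sum_j y j * x i j.

Lemma apply_arrayZ (r : R) (y : 'I_k -> R) (i : 'I_n) :
  apply_array (fun j => r * y j) i = r * apply_array y i.
Proof. by rewrite /apply_array mulr_sumr; apply: eq_bigr => j _; rewrite mulrA. Qed.

Lemma apply_arrayB (y y' : 'I_k -> R) (i : 'I_n) :
  apply_array (fun j => y j - y' j) i = apply_array y i - apply_array y' i.
Proof. by rewrite /apply_array -sumrB; apply: eq_bigr => j _; rewrite mulrBl. Qed.

Lemma sum_sqr_scaled (y : 'I_k -> R) (rho : R) : 0 < rho ->
  \sum_j y j ^+ 2 = rho ^+ 2 -> \sum_j (rho^-1 * y j) ^+ 2 = 1.
Proof.
move=> rho0 yr; under eq_bigr do rewrite exprMn.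
by rewrite -mulr_sumr yr exprVn mulVf// expf_neq0// gt_eqF.
Qed.

(* The l1 operator norm is dual to the largest Euclidean norm of a signed sum
   of rows, and the latter is controlled through the net. *)
Lemma l1_upper (M : R) : 0 <= M ->
  (forall z : grid k K, z \in net k K -> \sum_j grid_point z j ^+ 2 <= (1 : R) ->
    forall s : {ffun 'I_n -> bool},
      \sum_i (-1) ^+ s i * apply_array (grid_point z) i <= M) ->
  forall (y : 'I_k -> R) (rho : R), 0 <= rho -> \sum_j y j ^+ 2 <= rho ^+ 2 ->
    \sum_i `|apply_array y i| <= 2 * M * rho.
Proof.
move=> M0 netM y rho rho0 yrho.
(* With these signs the l1 norm is the inner product of [y] with the signed sum of rows [a]. *)
pose s := [ffun i => apply_array y i < 0].
pose a j := \sum_i (-1) ^+ s i * x i j.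
have sumE (y' : 'I_k -> R) :
    \sum_i (-1) ^+ s i * apply_array y' i = \sum_j a j * y' j.
  under eq_bigr do rewrite mulr_sumr.
  rewrite exchange_big/=; apply: eq_bigr => j _; rewrite /a mulr_suml.
  by apply: eq_bigr => i _; rewrite mulrCA mulrC.
have -> : \sum_i `|apply_array y i| = \sum_j a j * y j.
  rewrite -sumE; apply: eq_bigr => i _.
  by rewrite [X in _ * X]numEsign /s ffunE signrMK.
pose N := Num.sqrt (\sum_j a j ^+ 2).
have N2 : N ^+ 2 = \sum_j a j ^+ 2.
  by rewrite sqr_sqrtr// sumr_ge0// => j _; exact: sqr_ge0.
have N0 : 0 <= N by exact: sqrtr_ge0.
apply: (@le_trans _ _ (N * rho)); first by apply: cauchy_schwarz_sum; rewrite ?N2.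
rewrite ler_wpM2r//; have [->|N1] := eqVneq N 0; first by rewrite mulr_ge0.
have {N1}N1 : 0 < N by rewrite lt_def N1.
(* Approximating the direction of [a] itself by a net point gives [N <= M + N / K], hence
   [N <= 2 * M]. *)
have u1 : \sum_j (N^-1 * a j) ^+ 2 = 1 by exact: sum_sqr_scaled.
have [z zN [z1 _ zd]] := net_approx k0 K2 u1.
have h1 : \sum_j a j * grid_point z j <= M by rewrite -sumE; exact: netM.
have h2 : \sum_j a j * (N^-1 * a j - grid_point z j) <= N * K%:R^-1.
  by apply: cauchy_schwarz_sum; rewrite ?N2// invr_ge0.
have h3 : \sum_j a j * (N^-1 * a j) = N.
  under eq_bigr do rewrite mulrCA -expr2.
  by rewrite -mulr_sumr -N2 expr2 mulKf// gt_eqF.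
have h4 : \sum_j a j * (N^-1 * a j - grid_point z j) = N - \sum_j a j * grid_point z j.
  by under eq_bigr do rewrite mulrBr; rewrite sumrB h3.
have h5 : N * K%:R^-1 <= N / 2.
  by rewrite ler_wpM2l// lef_pV2 ?posrE ?ltr0n ?ler_nat// ltnW.
lra.
Qed.

(** After scaling to [rho = 1], replacing [y] by a net point costs [8 * n / K] and rounding [t] to a
    multiple of [K^-1] costs [n / K]. The total is at most [dl / 4 * n], half of the lower bound on
    the net. *)
Lemma l1_lower (dl : R) (v : 'I_n -> R) : (0 < n)%N ->
  (forall i, `|v i| <= 1) -> 9 / K%:R <= dl / 4 ->
  (forall (y : 'I_k -> R) (rho : R), 0 <= rho -> \sum_j y j ^+ 2 <= rho ^+ 2 ->
    \sum_i `|apply_array y i| <= 8 * n%:R * rho) ->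
  (forall z : grid k K, z \in net k K -> 4^-1 <= \sum_j grid_point z j ^+ 2 :> R ->
    forall p : bool * 'I_(K * n).+1,
      dl * n%:R / 2 <= \sum_i `|apply_array (grid_point z) i
                               - (-1) ^+ p.1 * (p.2%:R / K%:R) * v i|) ->
  forall (y : 'I_k -> R) (t rho : R), 0 < rho -> \sum_j y j ^+ 2 = rho ^+ 2 ->
    `|t| <= n%:R * rho ->
    dl / 4 * n%:R * rho <= \sum_i `|apply_array y i - t * v i|.
Proof.
move=> n0 v1 Kdl upper netlow y t rho rho0 yrho tn.
have K0 : 0 < K%:R :> R by rewrite ltr0n ltnW.
have n0R : 0 < n%:R :> R by rewrite ltr0n.
wlog rho1 : y t rho rho0 yrho tn / rho = 1.
  move=> H; have := H (fun j => rho^-1 * y j) (rho^-1 * t) 1 ltr01.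
  rewrite expr1n !mulr1 normrM ger0_norm ?invr_ge0 ?(ltW rho0)// ler_pdivrMl//.
  rewrite [rho * n%:R]mulrC => /(_ (sum_sqr_scaled rho0 yrho) tn erefl).
  under eq_bigr do rewrite apply_arrayZ -mulrA -mulrBr normrM ger0_norm ?invr_ge0 ?(ltW rho0)//.
  by rewrite -mulr_sumr -ler_pdivrMl ?invr_gt0// invrK mulrC.
rewrite {}rho1 ?mulr1 ?expr1n {rho rho0} in yrho tn *.
have [z zN [z1 z4 zd]] := net_approx k0 K2 yrho.
pose m := Num.truncn (`|t| * K%:R).
have tK0 : 0 <= `|t| * K%:R by rewrite mulr_ge0// ltW.
have mle : m%:R <= `|t| * K%:R by rewrite truncn_le.
have mgt : `|t| * K%:R < m%:R + 1 by rewrite natr1 truncnS_gt.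
have mKn : (m < (K * n).+1)%N.
  rewrite ltnS -(ler_nat R) (le_trans mle)// natrM mulrC.
  by rewrite ler_wpM2l// ltW.
pose t' := (-1) ^+ (t < 0)%R * (m%:R / K%:R) : R.
have tt' : `|t - t'| <= K%:R^-1.
  rewrite /t' [X in X - _]numEsign -mulrBr normrMsign ger0_norm.
    by rewrite -(ler_pM2r K0) mulrBl divfK ?mulVf ?gt_eqF// lerBlDl ltW.
  by rewrite subr_ge0 ler_pdivrMr.
have low := netlow z zN z4 (t < 0, Ordinal mKn).
have up := upper (fun j => y j - grid_point z j) K%:R^-1 _ zd.
have {}up : \sum_i `|apply_array y i - apply_array (grid_point z) i| <= 8 * n%:R / K%:R.
  under eq_bigr do rewrite -apply_arrayB.
  by apply: up; rewrite invr_ge0 ltW.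
have key : \sum_i `|apply_array (grid_point z) i - t' * v i| <=
   \sum_i `|apply_array y i - t * v i| +
   (\sum_i `|apply_array y i - apply_array (grid_point z) i| + \sum_(i < n) K%:R^-1).
  rewrite -!big_split/=; apply: ler_sum => i _.
  have h : `|(t - t') * v i| <= K%:R^-1.
    by rewrite normrM -[leRHS]mulr1 ler_pM.
  rewrite (_ : _ - t' * v i = (apply_array y i - t * v i) +
    (- (apply_array y i - apply_array (grid_point z) i) + (t - t') * v i)); last by ring.
  apply: (le_trans (ler_normD _ _)); rewrite lerD2l.
  by apply: (le_trans (ler_normD _ _)); rewrite normrN lerD2l.
move: key; rewrite sumr_const card_ord -[K%:R^-1 *+ n]mulr_natl => key.
have : n%:R * (9 / K%:R) <= n%:R * (dl / 4) by rewrite ler_wpM2l// ltW.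
move: low; rewrite -/t' /=.
rewrite /= -/t'; lra.
Qed.

End deterministic.

(** * Deterministic recovery *)

Lemma span_cons_enumP (F : fieldType) (vT : vectType F) (I : finType) (v : vT)
    (X : I -> vT) (z : vT) :
  z \in <<v :: [seq X j | j <- enum I]>>%VS ->
  exists a (y : I -> F), z = a *: v + \sum_j y j *: X j.
Proof.
rewrite span_cons => /memv_addP[_ /vlineP[a ->] [u]].
rewrite span_def big_map big_enum/= => /memv_sumP[us usX ->] ->.
have c j : exists c, us j = c *: X j.
  by have /vlineP[c ->] := usX j isT; exists c.
have [y yE] := choice c.
by exists a, y; congr (_ + _); apply: eq_bigr => j _.
Qed.

Lemma mx_norm_argmax {R : realType} (n : nat) (v : 'rV[R]_n) (i : 'I_n) :
  (forall j, `|v 0 j| <= `|v 0 i|) -> `|v| = `|v 0 i|.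
Proof.
move=> vi; apply/eqP; rewrite eq_le; apply/andP; split.
  rewrite [leLHS]/Num.Def.normr/= mx_normrE; apply: bigmax_le => // -[a b] _ /=.
  by rewrite ord1.
by rewrite [leRHS]/Num.Def.normr/= mx_normrE; apply/bigmax_geP; right => /=; exists (0, i).
Qed.

Section recovery.
Context {R : realType}.
Variables (n k : nat) (v : 'rV[R]_n) (i0 : 'I_n) (X : 'I_k -> 'rV[R]_n).
Hypotheses (n0 : (0 < n)%N) (k0 : (0 < k)%N) (v0 : v != 0).
Hypothesis vmax : forall j, `|v 0 j| <= `|v 0 i0|.

Lemma argmax_neq0 : v 0 i0 != 0.
Proof.
apply: contraNneq v0 => vis; apply/eqP/rowP => j; rewrite mxE; apply/eqP.
by rewrite -normr_le0 (le_trans (vmax j))// vis normr0.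
Qed.

Let vn : 'rV[R]_n := (v 0 i0)^-1 *: v.

Let vn_i0 : vn 0 i0 = 1. Proof. by rewrite mxE mulVf// argmax_neq0. Qed.

Lemma normalized_entry_le1 i : `|((v 0 i0)^-1 *: v) 0 i| <= 1.
Proof.
by rewrite mxE normrM normfV mulrC ler_pdivrMr ?mul1r// normr_gt0 argmax_neq0.
Qed.

Lemma best_sparse_approx_error (s : nat) (vs : 'rV[R]_n) :
  best_sparse_approx s v vs -> exists2 S : {set 'I_n}, (#|S| <= s)%N &
    l1norm (v - vs) / `|v| = \sum_(i in ~: S) `|vn 0 i|.
Proof.
move=> [S [cS _ vsE]]; exists S; first by rewrite cS geq_minl.
rewrite (mx_norm_argmax vmax) /l1norm [RHS]big_mkcond/= mulr_suml.
apply: eq_bigr => i _; rewrite vsE !mxE inE; case: ifP => iS.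
  by rewrite subrr normr0 mul0r.
by rewrite subr0 normrM normfV mulrC.
Qed.

(** With [u = z - vn], [|vn| <= |z| + |u|] is used on [S] and [|u| <= |z| + |vn|] off [S]; then the
    two l1 norms are compared. *)
Lemma minimizer_cone (S : {set 'I_n}) (z : 'rV[R]_n) : l1norm z <= l1norm vn ->
  l1norm (z - vn) <=
    2 * \sum_(i in S) `|(z - vn) 0 i| + 2 * \sum_(i in ~: S) `|vn 0 i|.
Proof.
move=> zv.
have split (F : 'I_n -> R) : \sum_i F i = \sum_(i in S) F i + \sum_(i in ~: S) F i.
  rewrite (bigID (mem S))/=; congr (_ + _); apply: eq_bigl => i.
  by rewrite inE.
have hS : \sum_(i in S) `|vn 0 i| <= \sum_(i in S) `|z 0 i| + \sum_(i in S) `|(z - vn) 0 i|.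
  rewrite -big_split/=; apply: ler_sum => i _; rewrite !mxE.
  have -> : `|(v 0 i0)^-1 * v 0 i| = `|z 0 i - (z 0 i - (v 0 i0)^-1 * v 0 i)|.
    by congr `|_|; ring.
  exact: ler_normB.
have hC : \sum_(i in ~: S) `|(z - vn) 0 i| <=
    \sum_(i in ~: S) `|z 0 i| + \sum_(i in ~: S) `|vn 0 i|.
  by rewrite -big_split/=; apply: ler_sum => i _; rewrite !mxE; exact: ler_normB.
move: zv; rewrite /l1norm !split => zv; lra.
Qed.

(* q bounds every coordinate of G y for y of norm 1. *)
Lemma minimizer_recovery (dl q : R) (s : nat) (vs z : 'rV[R]_n) :
  0 < dl -> 0 < q -> q <= n%:R ->
  (forall i j, `|X j 0 i| <= q / Num.sqrt k%:R) ->
  (forall (y : 'I_k -> R) (t rho : R), 0 < rho -> \sum_j y j ^+ 2 = rho ^+ 2 ->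
    `|t| <= n%:R * rho ->
    dl * n%:R * rho <=
      \sum_i `|apply_array (fun i j => X j 0 i) y i - t * vn 0 i|) ->
  best_sparse_approx s v vs -> s%:R * q <= dl / 8 * n%:R ->
  is_l1_minimizer <<v :: [seq X j | j <- enum 'I_k]>>%VS i0 z ->
  l2norm (z - vn) <= 8 / dl * (q / Num.sqrt n%:R) * (l1norm (v - vs) / `|v|).
Proof.
move=> dl0 q0 qn Xq low bsa sq [zW zis zmin].
have [S Ss ->] := best_sparse_approx_error bsa.
set sg := \sum_(i in ~: S) _.
have sg0 : 0 <= sg by apply: sumr_ge0.
have n0R : 0 < n%:R :> R by rewrite ltr0n.
have k0R : 0 < k%:R :> R by rewrite ltr0n.
have sn0 : 0 < Num.sqrt n%:R :> R by rewrite sqrtr_gt0.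
have sk0 : 0 < Num.sqrt k%:R :> R by rewrite sqrtr_gt0.
have vnW : vn \in <<v :: [seq X j | j <- enum 'I_k]>>%VS.
  by rewrite memvZ// memv_span// mem_head.
have cone := minimizer_cone S (zmin _ vnW vn_i0).
have [a [y zE]] := span_cons_enumP zW.
pose Gy := apply_array (fun i j => X j 0 i) y.
have zi i : z 0 i = a * v 0 i + Gy i.
  rewrite zE !mxE summxE; congr (_ + _); apply: eq_bigr => j _.
  by rewrite mxE.
(* The constraint [z 0 i0 = 1] fixes the coefficient of [v]: [a * v 0 i0 = 1 - t]. *)
pose t := Gy i0.
have uE i : (z - vn) 0 i = Gy i - t * vn 0 i.
  have av : a * v 0 i0 = 1 - t by rewrite -zis zi /t; ring.
  have vi : v 0 i = v 0 i0 * vn 0 i by rewrite mxE mulVKf// argmax_neq0.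
  have -> : (z - vn) 0 i = z 0 i - vn 0 i by rewrite !mxE.
  by rewrite zi vi mulrA av; ring.
pose rho := Num.sqrt (\sum_j y j ^+ 2).
have rho2 : \sum_j y j ^+ 2 = rho ^+ 2.
  by rewrite sqr_sqrtr// sumr_ge0// => j _; exact: sqr_ge0.
have rho0 : 0 <= rho by exact: sqrtr_ge0.
have Gq i : `|Gy i| <= q * rho.
  have xq : \sum_j (X j 0 i) ^+ 2 <= q ^+ 2.
    apply: (@le_trans _ _ (\sum_(j < k) (q / Num.sqrt k%:R) ^+ 2)).
      apply: ler_sum => j _; rewrite -[leLHS]real_normK ?num_real//.
      by rewrite lerXn2r ?nnegrE// divr_ge0// ltW.
    rewrite sumr_const card_ord expr_div_n sqr_sqrtr ?ler0n// -[leLHS]mulr_natr.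
    by rewrite divfK// gt_eqF.
  have yN : \sum_j (- y j) ^+ 2 <= rho ^+ 2.
    by under eq_bigr do rewrite sqrrN; rewrite rho2.
  rewrite mulrC ler_norml; apply/andP; split.
    rewrite lerNl /Gy /apply_array -sumrN.
    under eq_bigr do rewrite -mulNr.
    by apply: cauchy_schwarz_sum => //; exact: ltW.
  by apply: cauchy_schwarz_sum; rewrite ?rho2//; exact: ltW.
have uq i : `|(z - vn) 0 i| <= 2 * q * rho.
  rewrite uE; apply: (le_trans (ler_normB _ _)).
  have : `|t * vn 0 i| <= q * rho.
    by rewrite normrM -[leRHS]mulr1; apply: ler_pM => //; [exact: Gq|exact: normalized_entry_le1].
  have := Gq i; lra.
have l2u : l2norm (z - vn) <= Num.sqrt n%:R * (2 * q * rho).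
  rewrite /l2norm -[leRHS]ger0_norm ?mulr_ge0 ?(ltW q0)//.
  rewrite -sqrtr_sqr ler_sqrt ?sqr_ge0// exprMn sqr_sqrtr ?ler0n//.
  apply: (@le_trans _ _ (\sum_(i < n) (2 * q * rho) ^+ 2)).
    apply: ler_sum => i _; rewrite -[leLHS]real_normK ?num_real//.
    by rewrite lerXn2r ?nnegrE// !mulr_ge0// ltW.
  by rewrite sumr_const card_ord -[leLHS]mulr_natl.
have [r0|r1] := eqVneq rho 0.
  apply: (le_trans l2u); rewrite r0 !mulr0 !mulr_ge0 ?invr_ge0// ltW//.
have {r1}r0 : 0 < rho by rewrite lt_def r1.
have tn : `|t| <= n%:R * rho by rewrite (le_trans (Gq _))// ler_wpM2r.
have {}low := low y t rho r0 rho2 tn.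
have {}low : dl * n%:R * rho <= l1norm (z - vn).
  by rewrite /l1norm; under eq_bigr do rewrite uE.
(* At most [s] terms, each at most [2 * q * rho], and [s * q <= dl / 8 * n]. *)
have uS : \sum_(i in S) `|(z - vn) 0 i| <= dl / 4 * n%:R * rho.
  apply: (@le_trans _ _ (\sum_(i in S) (2 * q * rho))).
    by apply: ler_sum => i _.
  rewrite sumr_const -[leLHS]mulr_natl.
  apply: (@le_trans _ _ (s%:R * (2 * q * rho))).
    by rewrite ler_wpM2r ?ler_nat// !mulr_ge0// ltW.
  have := ler_wpM2r rho0 sq; lra.
(* In the cone inequality the part on [S] takes at most half of the lower bound [dl * n * rho], so
   the tail [sg] controls [rho]. *)
have rs : rho <= 4 / dl * (sg / n%:R).
  have h : dl * n%:R * rho <= 4 * sg.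
    have := le_trans low cone; rewrite -/sg; lra.
  rewrite -(ler_pM2l (mulr_gt0 dl0 n0R)) (le_trans h)//.
  by rewrite le_eqVlt; apply/orP; left; apply/eqP; field; rewrite !gt_eqF.
apply: (le_trans l2u).
have -> : 8 / dl * (q / Num.sqrt n%:R) * sg =
    Num.sqrt n%:R * (2 * q * (4 / dl * (sg / n%:R))).
  have -> : n%:R^-1 = (Num.sqrt n%:R ^+ 2)^-1 :> R by rewrite sqr_sqrtr ?ler0n.
  by field; rewrite !gt_eqF.
by rewrite ler_wpM2l ?(ltW sn0)// ler_wpM2l// mulr_ge0 ?(ltW q0).
Qed.

End recovery.

(** * The exceptional event *)

Section gaussian_vectors.
Context {R : realType}.

Lemma measurable_coord (n : nat) (i : 'I_n) :
  measurable_fun [set: borel_rV R n] (fun x : borel_rV R n => (x : 'rV[R]_n) 0 i).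
Proof.
apply: (measurability (@RGenOInfty.G R)); first exact: RGenOInfty.measurableE.
move=> _ [_ [a ->] <-]; rewrite setTI; apply: sub_sigma_algebra.
apply: open_comp; last exact: interval_open.
by move=> x _; exact: coord_continuous.
Qed.

Lemma measurable_box (n : nat) (A : 'I_n -> set R) : (forall i, measurable (A i)) ->
  measurable ([set x : 'rV[R]_n | forall i, A i (x 0 i)] : set (borel_rV R n)).
Proof.
move=> mA; rewrite (_ : [set x | _] =
    \bigcap_i (fun x : borel_rV R n => (x : 'rV[R]_n) 0 i) @^-1` A i); last first.
  by apply/seteqP; split => x Ax i; [move=> _|]; exact: Ax.
apply: fin_bigcap_measurable => // i _.
by rewrite -[X in measurable X]setTI; exact: measurable_coord.
Qed.

Context {d : measure_display} {T : measurableType d} (P : probability T R).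
Variables (n k : nat) (tv : 'I_k -> {RV P >-> borel_rV R n}).
Hypothesis tv_gauss : forall j, std_gaussian_vector (tv j).
Hypothesis tv_ind : mutually_independent tv.

Definition entry (a : 'I_n * 'I_k) (w : T) : R := (tv a.2 w : 'rV[R]_n) 0 a.1.

Lemma measurable_entry a : measurable_fun setT (entry a).
Proof.
apply: (measurableT_comp (measurable_coord a.1)); exact: measurable_funPT.
Qed.

Lemma entry_law a (A : set R) : measurable A ->
  P (entry a @^-1` A) = normal_prob 0 1 A.
Proof.
case: a => i j mA; pose B i' := if i' == i then A else setT.
have mB i' : measurable (B i') by rewrite /B; case: ifP.
have := tv_gauss j mB; rewrite (bigD1 i)//= /B eqxx big1 ?mule1; last first.
  by move=> i' /negbTE ->; exact: probability_setT.
move=> <-; congr (P _); apply/seteqP; split => w /=; rewrite /entry/=.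
  by move=> Aw i'; case: eqVneq => [->|].
by move=> /(_ i); rewrite eqxx.
Qed.

(** Conditions on the entries say that each [tv j] lies in a box [A j]. Independence of the vectors
    and the product form of each law give a double product over all entries. *)
Lemma entry_independent : independent P entry.
Proof.
split=> [a|B mB]; first exact: measurable_entry.
pose A j : set (borel_rV R n) := [set x : 'rV[R]_n | forall i, B (i, j) (x 0 i)].
have mA j : measurable (A j).
  by apply: (@measurable_box n (fun i => B (i, j))) => i; exact: mB.
have -> : \bigcap_a entry a @^-1` B a =
    \bigcap_(j in [set` [set: 'I_k]%SET]) tv j @^-1` A j.
  apply/seteqP; split => w Aw.
    by move=> j _ i; exact: (Aw (i, j) I).
  by case=> i j _; have := Aw j; rewrite /= inE => /(_ isT) /(_ i).
rewrite tv_ind// (eq_bigl xpredT); last by move=> j; rewrite inE.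
rewrite (eq_bigr (fun j => \prod_i normal_prob 0 1 (B (i, j)))%E); last first.
  by move=> j _; exact: (tv_gauss j (fun i => mB (i, j))).
rewrite exchange_big/= pair_bigA/=; apply: eq_bigr => -[i j] _.
by rewrite entry_law.
Qed.

Lemma entry_gauss a : gauss_transform P (entry a) 1.
Proof.
move=> lam th lam0; rewrite mulr1 mul1r -integral_expR_normal01//.
have mf : measurable_fun setT (fun x : R => (expR (- (lam * x ^+ 2) + th * x))%:E).
  exact: (@measurable_expR_quad _ _ _ (fun x : R => x)).
have mX : measurable_fun setT (entry a : T -> measurableTypeR R).
  exact: measurable_entry.
rewrite -(@eq_measure_integral _ (measurableTypeR R) R setT (normal_prob 0 1)
  (pushforward P (entry a : T -> measurableTypeR R))) => [|A mA _]; last first.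
  exact: entry_law.
by rewrite ge0_integral_pushforward// => x _; rewrite lee_fin expR_ge0.
Qed.

End gaussian_vectors.

(** * Union bounds over entries, signs, net points and shifts *)

Section bad_event.
Context {R : realType} {d : measure_display} {T : measurableType d}.
Variable P : probability T R.

(** The union runs over the full finite type, but events off [N] are empty, so only [#|N|] enters
    the count. *)
Lemma measure_bigcup_pair_le (Z Q : finType) (N : {set Z}) (A : Z * Q -> set T)
    (c : R) : 0 <= c -> (forall p, measurable (A p)) ->
  (forall p, p.1 \notin N -> A p = set0) -> (forall p, (P (A p) <= c%:E)%E) ->
  (P (\bigcup_p A p) <= (#|N|%:R * #|Q|%:R * c)%:E)%E.
Proof.
move=> c0 mA AN Ac; apply: (le_trans (measure_bigcup_le P mA)).
apply: (@le_trans _ _ (\sum_p (if p.1 \in N then c else 0)%:E)%E).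
  by apply: lee_sum => p _; case: ifPn => // /AN ->; rewrite measure0.
rewrite sumEFin lee_fin -(pair_bigA _ (fun z (q : Q) => if z \in N then c else 0))/=.
under eq_bigr do rewrite sumr_const.
rewrite sumrMnl -big_mkcond/= sumr_const -mulrnA -[leLHS]mulr_natl natrM.
by [].
Qed.

Variables (n k K : nat) (xi : 'I_n * 'I_k -> T -> R) (vn : 'I_n -> R).
Hypothesis xi_ind : independent P xi.
Hypothesis xi_gauss : forall a, gauss_transform P (xi a) 1.
Hypotheses (n1 : (1 < n)%N) (k0 : (0 < k)%N) (kn : (32 * k <= n)%N).
Hypothesis KE : K%:R = 2 ^+ 17 :> R.
Hypothesis vn1 : forall i, `|vn i| <= 1.

Let n0R : 0 < n%:R :> R. Proof. by rewrite ltr0n ltnW. Qed.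

Let K2 : (1 < K)%N.
Proof. by rewrite -(ltr_nat R) KE exprn_egt1//; lra. Qed.

(** Here [32 * k <= n] enters: each of the [k] coordinates contributes a factor
    [8 * (K + 1) <= 2 ^+ 32]. *)
Let net_card_le : #|net k K|%:R <= 2 ^+ n :> R.
Proof.
apply: (le_trans (net_card k K2)).
apply: (@le_trans _ _ ((2 ^+ 32) ^+ k)).
  rewrite lerXn2r ?nnegrE ?mulr_ge0 ?exprn_ge0//.
  rewrite -[K.+1%:R]natr1 KE; lra.
by rewrite -exprM ler_weXn2l// ler1n.
Qed.

Let expR_half : (2^-1) ^+ n <= expR (- (1 * n%:R / 2)) :> R.
Proof.
rewrite (_ : - (1 * n%:R / 2) = n%:R * - 2^-1); last by field.
rewrite expRM_natl lerXn2r ?nnegrE ?expR_ge0 ?invr_ge0//.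
by have := @expR_ge1Dx R (- 2^-1); lra.
Qed.

Let large_entry := \bigcup_a [set w | 3 * Num.sqrt (ln n%:R) <= `|xi a w|].

Let measurable_le (f : T -> R) (t : R) : measurable_fun setT f ->
  measurable [set w | t <= f w].
Proof.
move=> mf; rewrite (_ : [set w | _] = f @^-1` `[t, +oo[).
  exact: preimage_measurable.
by apply/seteqP; split => w /=; rewrite in_itv/= andbT.
Qed.

Let measurable_lt (f : T -> R) (t : R) : measurable_fun setT f ->
  measurable [set w | f w < t].
Proof.
move=> mf; rewrite (_ : [set w | _] = f @^-1` `]-oo, t[).
  exact: preimage_measurable.
by apply/seteqP; split => w /=; rewrite in_itv/=.
Qed.

Let measurable_large_entry : measurable large_entry.
Proof.
apply: fin_bigcup_measurable => // a _; apply: measurable_le.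
by apply: measurableT_comp => //; exact: xi_ind.1.
Qed.

(** At level [3 * Num.sqrt (ln n)] the tail exponent is [9 / 2 * ln n], so each of the [n * k]
    entries fails with probability at most [2 * n ^- 4]; finally [2 <= n]. *)
Let large_entry_prob : (P large_entry <= (k%:R / n%:R ^+ 2)%:E)%E.
Proof.
apply: (le_trans (measure_bigcup_le P _)) => [a|].
  by apply: measurable_le; apply: measurableT_comp => //; exact: xi_ind.1.
have ln0 : 0 <= ln n%:R :> R by rewrite ln_ge0// ler1n ltnW.
apply: (@le_trans _ _ (\sum_(a : 'I_n * 'I_k) (2 * n%:R ^- 4)%:E)%E).
  apply: lee_sum => a _; apply: (le_trans (entry_tail xi_ind xi_gauss a _)).
    by rewrite mulr_ge0.
  rewrite lee_fin ler_wpM2l// exprMn sqr_sqrtr//.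
  apply: (@le_trans _ _ (expR (- (4%:R * ln n%:R)))).
    by rewrite ler_expR; lra.
  by rewrite expRN expRM_natl lnK ?posrE.
rewrite sumEFin lee_fin sumr_const card_prod !card_ord -[leLHS]mulr_natl natrM.
have -> : n%:R * k%:R * (2 * n%:R ^- 4) = (k%:R / n%:R ^+ 2) * (2 / n%:R) :> R.
  by field; rewrite gt_eqF.
rewrite ler_piMr ?divr_ge0 ?exprn_ge0//.
by rewrite ler_pdivrMr// mul1r ler_nat.
Qed.

Let large_sum (p : grid k K * {ffun 'I_n -> bool}) : set T :=
  if (p.1 \in net k K) && (\sum_j grid_point p.1 j ^+ 2 <= (1 : R))
  then [set w | 4 * n%:R <= \sum_i (-1) ^+ p.2 i * row_form xi (grid_point p.1) i w]
  else set0.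

Let measurable_large_sum p : measurable (large_sum p).
Proof.
rewrite /large_sum; case: ifP => // _; apply: measurable_le.
apply: measurable_sum => i; apply: measurable_funM => //.
exact: (measurable_row_form xi_ind).
Qed.

(** At most [2 ^+ n] net points, [2 ^+ n] sign patterns, and [8^-1 ^+ n] for each pair. *)
Let large_sum_prob : (P (\bigcup_p large_sum p) <= (2^-1 ^+ n)%:E)%E.
Proof.
have e8 : expR (- (8 * n%:R)) <= 8^-1 ^+ n :> R.
  rewrite (_ : - (8 * n%:R) = n%:R * - 8); last by ring.
  rewrite expRM_natl lerXn2r ?nnegrE ?expR_ge0 ?invr_ge0// expRN.
  rewrite lef_pV2 ?posrE ?expR_gt0//.
  by have := @expR_ge1Dx R 8; lra.
have c0 : 0 <= 8^-1 ^+ n :> R by rewrite exprn_ge0// invr_ge0.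
have AN p : p.1 \notin net k K -> large_sum p = set0.
  by move=> pN; rewrite /large_sum (negbTE pN).
have Ac p : (P (large_sum p) <= (8^-1 ^+ n)%:E)%E.
  rewrite /large_sum; case: ifP => [/andP[_ p1]|_]; last by rewrite measure0 lee_fin.
  apply: (le_trans (signed_sum_tail xi_ind xi_gauss _ (ltnW n1) p1)).
  by rewrite lee_fin.
apply: (le_trans (measure_bigcup_pair_le c0 measurable_large_sum AN Ac)).
rewrite lee_fin card_ffun card_bool card_ord natrX.
apply: (@le_trans _ _ (2 ^+ n * 2 ^+ n * 8^-1 ^+ n)).
  by rewrite !ler_wpM2r ?exprn_ge0 ?invr_ge0.
rewrite -!exprMn lerXn2r ?nnegrE; lra.
Qed.

Let small_norm (p : grid k K * (bool * 'I_(K * n).+1)) : set T :=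
  if (p.1 \in net k K) && (4^-1 <= \sum_j grid_point p.1 j ^+ 2 :> R)
  then [set w | \sum_i `|row_form xi (grid_point p.1) i w
                         - (-1) ^+ p.2.1 * (p.2.2%:R / K%:R) * vn i|
                < 2^-1 ^+ 11 * n%:R / 2]
  else set0.

Let measurable_small_norm p : measurable (small_norm p).
Proof.
rewrite /small_norm; case: ifP => // _; apply: measurable_lt.
apply: measurable_sum => i; apply: measurableT_comp => //.
by apply: measurable_funB => //; exact: (measurable_row_form xi_ind).
Qed.

(** At most [2 ^+ n] net points and [2 * (K * n + 1) <= 4 * K * 2 ^+ n] shifts, with [8^-1 ^+ n] for
    each pair. *)
Let small_norm_prob : (P (\bigcup_p small_norm p) <= (4 * K%:R * 2^-1 ^+ n)%:E)%E.
Proof.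
have c0 : 0 <= 8^-1 ^+ n :> R by rewrite exprn_ge0// invr_ge0.
have AN p : p.1 \notin net k K -> small_norm p = set0.
  by move=> pN; rewrite /small_norm (negbTE pN).
have Ac p : (P (small_norm p) <= (8^-1 ^+ n)%:E)%E.
  rewrite /small_norm; case: ifP => [/andP[_ p1]|_]; last by rewrite measure0 lee_fin.
  exact: (small_l1_prob xi_ind xi_gauss _ p1).
apply: (le_trans (measure_bigcup_pair_le c0 measurable_small_norm AN Ac)).
rewrite lee_fin card_prod card_bool card_ord natrM.
apply: (@le_trans _ _ (2 ^+ n * (4 * K%:R * 2 ^+ n) * 8^-1 ^+ n)).
  rewrite ler_wpM2r ?exprn_ge0 ?invr_ge0// ler_pM//.
  have n2 : n%:R <= 2 ^+ n :> R by rewrite -natrX ler_nat ltnW// ltn_expl.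
  have Kn1 : 1 <= K%:R * n%:R :> R by rewrite -natrM ler1n muln_gt0 (ltnW K2) (ltnW n1).
  have := ler_wpM2l (ler0n R K) n2.
  by rewrite -[X in 2 * X]natr1 natrM; lra.
rewrite mulrCA -!mulrA [X in _ * (_ * X)]mulrA -!exprMn.
rewrite (_ : 2 * 2 * 8^-1 = 2^-1 :> R)//; lra.
Qed.

Lemma gaussian_array_bad_event : exists F : set T,
  [/\ measurable F,
      (P F <= (k%:R / n%:R ^+ 2
               + (4 * K%:R + 1) * expR (- (1 * n%:R / 2)))%:E)%E
    & forall w, ~ F w ->
      (forall i j, `|xi (i, j) w| <= 3 * Num.sqrt (ln n%:R)) /\
      (forall (y : 'I_k -> R) (t rho : R), 0 < rho ->
        \sum_j y j ^+ 2 = rho ^+ 2 -> `|t| <= n%:R * rho ->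
        2^-1 ^+ 13 * n%:R * rho <=
          \sum_i `|apply_array (fun i j => xi (i, j) w) y i - t * vn i|)].
Proof.
pose F2 := \bigcup_p large_sum p; pose F3 := \bigcup_p small_norm p.
have mF2 : measurable F2.
  by apply: fin_bigcup_measurable => [|p _]; [exact: finite_finset|exact: measurable_large_sum].
have mF3 : measurable F3.
  by apply: fin_bigcup_measurable => [|p _]; [exact: finite_finset|exact: measurable_small_norm].
exists (large_entry `|` (F2 `|` F3)); split.
- by apply: measurableU => //; exact: measurableU.
- apply: (le_trans (measureU2 _ _ _)) => //; first exact: measurableU.
  rewrite EFinD leeD//; apply: (le_trans (measureU2 _ _ _)) => //.
  apply: (le_trans (leeD large_sum_prob small_norm_prob)).
  rewrite -EFinD lee_fin addrC -[X in _ + X]mul1r -mulrDl.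
  by rewrite ler_wpM2l// addr_ge0// mulr_ge0.
move=> w Fw.
have F1w : ~ large_entry w by move=> ?; apply: Fw; left.
have F2w : ~ F2 w by move=> ?; apply: Fw; right; left.
have F3w : ~ F3 w by move=> ?; apply: Fw; right; right.
split=> [i j|].
  by rewrite leNgt; apply/negP => h; apply: F1w; exists (i, j) => //=; exact: ltW.
have up := @l1_upper _ n k K (fun i j => xi (i, j) w) k0 K2 (4 * n%:R) _ _.
have {}up (y : 'I_k -> R) (rho : R) : 0 <= rho -> \sum_j y j ^+ 2 <= rho ^+ 2 ->
    \sum_i `|apply_array (fun i j => xi (i, j) w) y i| <= 8 * n%:R * rho.
  rewrite (_ : 8 * n%:R = 2 * (4 * n%:R)); last by ring.
  apply: up; first by rewrite mulr_ge0.
  move=> z zN z1 s; rewrite leNgt; apply/negP => h; apply: F2w.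
  by exists (z, s) => //; rewrite /large_sum/= zN z1 /=; exact: ltW.
(* [l1_lower] is used with [dl = 2^-1 ^+ 11]; then [K = 2 ^+ 17] satisfies [9 / K <= dl / 4]. *)
rewrite (_ : 2^-1 ^+ 13 = 2^-1 ^+ 11 / 4); last by field.
apply: (l1_lower k0 K2 _ vn1 _ up); first exact: ltnW.
  by rewrite KE; lra.
move=> z zN z4 p; rewrite leNgt; apply/negP => h; apply: F3w.
by exists (z, p) => //; rewrite /small_norm/= zN z4.
Qed.

End bad_event.

(** * Choice of the constants and conclusion *)

Theorem theorem2 (R : realType) :
  exists (c C g1 g2 : R) (N : nat),
    [/\ 0 < c, 0 < C, 0 < g1 & 0 < g2] /\
    forall (n k : nat), (N <= n)%N -> (1 <= k)%N -> (k%:R <= n%:R / 32 :> R) ->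
    forall (v : 'rV[R]_n), v != 0 ->
    forall (istar : 'I_n), (forall j, `|v 0 j| <= `|v 0 istar|) ->
    forall (vs : 'rV[R]_n),
      best_sparse_approx
        (Num.truncn (c * ((n%:R / Num.sqrt (ln n%:R)) / Num.sqrt k%:R))) v vs ->
    forall (d : measure_display) (T : measurableType d) (P : probability T R)
      (tv : 'I_k -> {RV P >-> borel_rV R n}),
      (forall j, std_gaussian_vector (tv j)) ->
      mutually_independent tv ->
    let W (w : T) : {vspace 'rV[R]_n} :=
      <<v :: [seq (tv j w : 'rV[R]_n) | j <- enum 'I_k]>>%VS in
    exists E : set T,
      [/\ measurable E,
          ((1 - g1 * expR (- (g2 * n%:R / 2))
              - k%:R * expR (- (Num.floor (c * Num.sqrt (n%:R / ln n%:R)))%:~R)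
              - k%:R / n%:R ^+ 2)%:E <= P E)%E
        & forall w, E w -> forall z : 'rV[R]_n,
            is_l1_minimizer (W w) istar z ->
            l2norm (z - (v 0 istar)^-1 *: v)
              <= C * (Num.sqrt (k%:R * ln n%:R) / Num.sqrt n%:R)
                   * (l1norm (v - vs) / `|v|)].
Proof.
(* [K] is known only through its real value, so the natural number [2 ^ 17] stays opaque. *)
have [K KE] : exists K : nat, K%:R = 2 ^+ 17 :> R.
  by exists (2 ^ 17)%N; exact: natrX.
(* With [dl = 2^-1 ^+ 13], the second constant is [3 * 8 / dl], and the first satisfies
   [3 * c <= dl / 8]. The next two come from the bad event. The threshold is 0 because [1 <= k] and
   [32 * k <= n] already force [n >= 32]. *)
exists (2^-1 ^+ 18), (3 * 2 ^+ 16), (4 * K%:R + 1), 1, 0%N.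
split.
  by split; rewrite ?exprn_gt0 ?invr_gt0 ?mulr_gt0 ?exprn_gt0// ltr_wpDl// mulr_ge0.
move=> n k _ k1 kn v v0 i0 vmax vs bsa d T P tv tvg tvi W.
have kn32 : (32 * k <= n)%N.
  by rewrite -(ler_nat R) natrM mulrC -ler_pdivlMr.
have n1 : (1 < n)%N by lia.
have n0R : 0 < n%:R :> R by rewrite ltr0n ltnW.
have k0R : 0 < k%:R :> R by rewrite ltr0n.
have ln0 : 0 < ln n%:R :> R by rewrite ln_gt0// ltr1n.
have sl0 : 0 < Num.sqrt (ln n%:R) :> R by rewrite sqrtr_gt0.
have sk0 : 0 < Num.sqrt k%:R :> R by rewrite sqrtr_gt0.
have vn1 i : `|((v 0 i0)^-1 *: v) 0 i| <= 1 by exact: normalized_entry_le1.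
have [F [mF PF Fw]] := gaussian_array_bad_event
  (entry_independent tvg tvi) (entry_gauss tvg) n1 k1 kn32 KE vn1.
exists (~` F); split.
- exact: measurableC.
- rewrite probability_setC//; apply: (@le_trans _ _ (1%:E - (k%:R / n%:R ^+ 2
    + (4 * K%:R + 1) * expR (- (1 * n%:R / 2)))%:E)%E); last exact: leeB.
  rewrite -EFinB lee_fin.
  have : 0 <= k%:R * expR (- (Num.floor (2^-1 ^+ 18 * Num.sqrt (n%:R / ln n%:R) : R))%:~R) :> R.
    by apply: mulr_ge0; [exact: ler0n|exact: expR_ge0].
  lra.
move=> w /Fw[xle low] z zmin.
pose q := 3 * Num.sqrt (ln n%:R) * Num.sqrt k%:R : R.
have q0 : 0 < q by rewrite !mulr_gt0.
(* Squared: [9 * k * ln n <= 9 / 32 * n ^+ 2], from [ln n <= n] and [k <= n / 32]. *)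
have qn : q <= n%:R.
  rewrite -(@ler_pXn2r _ 2) ?nnegrE ?(ltW q0)// !exprMn !sqr_sqrtr ?ler0n ?(ltW ln0)//.
  have lnn : ln n%:R <= n%:R :> R.
    have h : -1 < n%:R - 1 :> R by lra.
    by have := le_ln1Dx h; rewrite addrCA subrr addr0; lra.
  have := ler_pM (ltW ln0) (ltW k0R) lnn kn.
  have : 0 < n%:R ^+ 2 :> R by rewrite exprn_gt0.
  lra.
(* The roots in [q] cancel those in the sparsity level, leaving [3 * 2^-1 ^+ 18 <= 2^-1 ^+ 16]. *)
have sq : (Num.truncn (2^-1 ^+ 18 * ((n%:R / Num.sqrt (ln n%:R)) / Num.sqrt k%:R) : R))%:R * q
    <= 2^-1 ^+ 13 / 8 * n%:R :> R.
  apply: (@le_trans _ _ (2^-1 ^+ 18 * ((n%:R / Num.sqrt (ln n%:R)) / Num.sqrt k%:R) * q)).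
    rewrite ler_wpM2r ?(ltW q0)// truncn_le.
    by rewrite mulr_ge0 ?exprn_ge0 ?invr_ge0 ?divr_ge0.
  rewrite (_ : _ * q = 2^-1 ^+ 18 * (3 * n%:R)); last first.
    by rewrite /q; field; rewrite !gt_eqF.
  by lra.
have dl0 : 0 < 2^-1 ^+ 13 :> R by rewrite exprn_gt0// invr_gt0.
have xq i j : `|(tv j w : 'rV[R]_n) 0 i| <= q / Num.sqrt k%:R.
  by rewrite /q mulfK ?gt_eqF//; exact: xle.
have := minimizer_recovery (ltnW n1) k1 v0 vmax dl0 q0 qn xq low bsa sq zmin.
have -> : 8 / 2^-1 ^+ 13 * (q / Num.sqrt n%:R) =
    3 * 2 ^+ 16 * (Num.sqrt (k%:R * ln n%:R) / Num.sqrt n%:R).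
  by rewrite /q sqrtrM ?ler0n//; field; rewrite gt_eqF ?sqrtr_gt0.
by [].
Qed.
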